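(* Let $F$ and $T$ be Thompson's groups. The following statements are equivalent: (i) the group $F$ is non-amenable; (ii) the group $F$ is $C^\ast$-simple; (iii) the group $T$ is $C^\ast$-simple.
   Context: Thompson's group $T$ is the group of orientation preserving homeomorphisms of $\mathbb{S}^1=\mathbb{R}/\mathbb{Z}$ which are piecewise linear, with only finitely many breakpoints, all at dyadic rationals, slopes in $2^{\mathbb{Z}}$, and preserving the set of dyadic rationals (as is part of the usual definition). Thompson's group $F$ is the subgroup of $T$ that stabilizes the point $0\in\mathbb{S}^1$ (equivalently, the group of orientation preserving piecewise linear homeomorphisms of $[0,1]$ with finitely many breakpoints, all dyadic rationals, and slopes in $2^{\mathbb{Z}}$). A group is $C^\ast$-simple if its reduced $C^\ast$-algebra is simple. *)

(* Defs.v *)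
From HB Require Import structures.
From mathcomp Require Import all_boot all_order all_algebra.
From mathcomp Require Import generic_quotient.
From mathcomp Require Import complex ring.
From mathcomp Require Import all_classical all_reals all_analysis.
Import Order.TTheory GRing.Theory Num.Theory.
Import numFieldNormedType.Exports.

Set Implicit Arguments.
Unset Strict Implicit.
Unset Printing Implicit Defensive.

Local Open Scope classical_set_scope.
Local Open Scope ring_scope.
Local Open Scope quotient_scope.

Section Circle.
Variable R : realType.

Definition eq_mod1 (x y : R) : bool := x - y \is a Num.int.

Lemma eq_mod1_refl : reflexive eq_mod1.
Proof. by move=> x; rewrite /eq_mod1 subrr rpred0. Qed.

Lemma eq_mod1_sym : symmetric eq_mod1.
Proof. by move=> x y; rewrite /eq_mod1 -rpredN opprB. Qed.

Lemma eq_mod1_trans : transitive eq_mod1.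
Proof.
by move=> y x z; rewrite /eq_mod1 => xy yz; rewrite -(subrKA y) rpredD.
Qed.

Canonical eq_mod1_equiv :=
  EquivRel eq_mod1 eq_mod1_refl eq_mod1_sym eq_mod1_trans.

Definition circle := quotient_topology {eq_quot eq_mod1_equiv}.

HB.instance Definition _ := Topological.on circle.

Definition circle_proj (x : R) : circle := \pi_{eq_quot eq_mod1_equiv} x.

Lemma circle_projP x y : circle_proj x = circle_proj y <-> x - y \is a Num.int.
Proof. by split => [/eqmodP|h]; last exact/eqmodP. Qed.

Lemma circle_proj_surj (p : circle) : exists x, circle_proj x = p.
Proof. by exists (repr p); rewrite /circle_proj reprK. Qed.

Definition dyadic : set R :=
  [set x | exists (m : int) (n : nat), x = m%:~R / 2 ^+ n].

Definition circle_dyadic : set circle := circle_proj @` dyadic.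

End Circle.

Arguments dyadic : clear implicits.
Arguments circle_dyadic : clear implicits.

Section Homeo.
Variable X : topologicalType.

Record homeo := Homeo {
  homeo_fun :> X -> X;
  homeo_inv : X -> X;
  homeo_funK : cancel homeo_fun homeo_inv;
  homeo_invK : cancel homeo_inv homeo_fun;
  homeo_cont : continuous homeo_fun;
  homeo_inv_cont : continuous homeo_inv
}.

Lemma homeoP (f g : homeo) : (forall x, f x = g x) -> f = g.
Proof.
case: f g => [f f' fK f'K cf cf'] [g g' gK g'K cg cg'] /= fg.
have {}fg : f = g by exact/funext.
subst g; have f'g' : f' = g'.
  by apply/funext => x; rewrite -{1}(g'K x) fK.
by subst g'; congr Homeo; exact: Prop_irrelevance.
Qed.

HB.instance Definition _ := gen_eqMixin homeo.
HB.instance Definition _ := gen_choiceMixin homeo.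

Definition homeo1 : homeo :=
  @Homeo idfun idfun (fun=> erefl) (fun=> erefl)
    (fun x => @cvg_id _ (nbhs x)) (fun x => @cvg_id _ (nbhs x)).

Definition homeoV (f : homeo) : homeo :=
  Homeo (@homeo_invK f) (@homeo_funK f)
    (@homeo_inv_cont f) (@homeo_cont f).

Definition homeoM (f g : homeo) : homeo :=
  Homeo (can_comp (@homeo_funK f) (@homeo_funK g))
    (can_comp (@homeo_invK g) (@homeo_invK f))
    (fun x => continuous_comp (@homeo_cont g x) (@homeo_cont f (g x)))
    (fun x => continuous_comp (@homeo_inv_cont f x)
                              (@homeo_inv_cont g (homeo_inv f x))).

Lemma homeo_mulA : associative homeoM.
Proof. by move=> f g h; exact: homeoP. Qed.

Lemma homeo_mul1 : left_id homeo1 homeoM.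
Proof. by move=> f; exact: homeoP. Qed.

Lemma homeo_mulr1 : right_id homeo1 homeoM.
Proof. by move=> f; exact: homeoP. Qed.

Lemma homeo_mulV : left_inverse homeo1 homeoV homeoM.
Proof. by move=> f; apply: homeoP => x /=; exact: homeo_funK. Qed.

Lemma homeo_mulrV : right_inverse homeo1 homeoV homeoM.
Proof. by move=> f; apply: homeoP => x /=; exact: homeo_invK. Qed.

HB.instance Definition _ := isGroup.Build homeo
  homeo_mulA homeo_mul1 homeo_mulr1 homeo_mulV homeo_mulrV.

End Homeo.

Section Thompson.
Variable R : realType.
Local Notation circle := (circle R).
Local Notation proj := (@circle_proj R).

(* A homeomorphism of the circle preserves orientation iff it lifts through
   [circle_proj] to an increasing homeomorphism [h] of the line commuting with
   the translation by 1; surjectivity of [h] follows from continuity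
   (see [lift_bij]). *)
Definition increasing_lift (f : circle -> circle) (h : R -> R) : Prop :=
  [/\ continuous h,
      {homo h : x y / x < y},
      forall x, h (x + 1) = h x + 1 &
      forall x, f (proj x) = proj (h x)].

(* [B] contains the breakpoints; the slope [2 ^ k] has an integer exponent, and
   only finitely many breakpoints are allowed per period of [h]. *)
Definition dyadic_piecewise_linear (h : R -> R) : Prop :=
  exists B : set circle,
    [/\ finite_set B,
        B `<=` circle_dyadic R &
        forall x, ~ B (proj x) ->
          exists k : int, \forall y \near x, h y = h x + 2 ^ k * (y - x)].

Definition is_thompsonT (f : homeo circle) : Prop :=
  (exists h, increasing_lift f h /\ dyadic_piecewise_linear h) /\
  f @` circle_dyadic R = circle_dyadic R.

Lemma lift_addz f h (n : int) x :
  increasing_lift f h -> h (x + n%:~R) = h x + n%:~R.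
Proof.
case=> _ _ h1 _.
have hn (m : nat) y : h (y + m%:R) = h y + m%:R.
  by elim: m => [|m IH]; rewrite ?addr0// -natr1 !addrA h1 IH.
case: n => m; first exact: hn.
rewrite NegzE mulrNz; apply/eqP; rewrite -subr_eq opprK -hn.
by rewrite -pmulrn subrK.
Qed.

Lemma lift_bij f h : increasing_lift f h ->
  exists h', cancel h h' /\ cancel h' h.
Proof.
move=> hf; have [ch ih h1 _] := hf.
have hinj : injective h.
  by move=> x y hxy; case: (ltgtP x y) => // /ih; rewrite hxy ltxx.
have hsurj y : exists x, h x = y.
  pose n : int := Num.floor (y - h 0).
  have le1 : h (n%:~R) <= y.
    by rewrite -(add0r n%:~R) (lift_addz _ _ hf) -lerBrDl floor_le.
  have le2 : y <= h (n%:~R + 1).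
    rewrite h1 -(add0r n%:~R) (lift_addz _ _ hf) -addrA -lerBlDl.
    by apply/ltW; have := floorD1_gt (y - h 0); rewrite intrD.
  have le01 : n%:~R <= n%:~R + 1 :> R by rewrite lerDl.
  have [|x _ hx] := @IVT R h n%:~R (n%:~R + 1) y le01 (continuous_subspaceT ch).
    by rewrite ge_min le_max le1 le2 orbT.
  by exists x.
have /choice[h' h'K] := hsurj.
by exists h'; split => // x; apply: hinj; rewrite h'K.
Qed.

Lemma is_thompsonT1 : is_thompsonT 1%g.
Proof.
split; last by rewrite image_id.
exists id; split; first by split => // x; exact: cvg_id.
exists set0; split => // x _.
by exists 0; near=> y; rewrite expr0z mul1r addrC subrK.
Unshelve. all: by end_near. Qed.

Lemma is_thompsonTM f g :
  is_thompsonT f -> is_thompsonT g -> is_thompsonT (f * g)%g.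
Proof.
move=> [[a [[ca ia a1 fa] [A [Afin Ady Aaff]]]] fD].
move=> [[b [[cb ib b1 gb] [B [Bfin Bdy Baff]]]] gD].
split; last first.
  rewrite -[RHS]fD -[in RHS]gD -image_comp.
  by apply: eq_imagel => p _.
exists (a \o b); split.
  split => [x|x y xy|x|x] /=.
  - by apply: continuous_comp; [exact: cb|exact: ca].
  - exact/ia/ib.
  - by rewrite b1 a1.
  - by rewrite -fa -gb.
exists (B `|` homeo_inv g @` A); split.
- by rewrite finite_setU; split => //; exact: finite_image.
- move=> p [/Bdy//|[q /Ady qD <-]].
  by move: qD; rewrite -{1}gD => -[r rD <-]; rewrite homeo_funK.
- move=> x /not_orP[xB xA].
  have [k bx] := Baff x xB.
  have [|l al] := Aaff (b x).
    move=> xA'; apply: xA; exists (proj (b x)) => //.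
    by rewrite -gb homeo_funK.
  exists (l + k); near=> y => /=.
  have -> : a (b y) = a (b x) + 2 ^ l * (b y - b x).
    by near: y; exact: (cb x _ al).
  have -> : b y = b x + 2 ^ k * (y - x) by near: y.
  by rewrite [b x + _]addrC addrK expfzDr// mulrA.
Unshelve. all: by end_near. Qed.

Lemma is_thompsonTV f : is_thompsonT f -> is_thompsonT (f^-1)%g.
Proof.
move=> [[a [fa [A [Afin Ady Aaff]]]] fD].
have [a' [aK a'K]] := lift_bij fa.
have [ca ia a1 faE] := fa.
have ca' : continuous a'.
  move=> y.
  have := @near_can_continuous R a a' (a' y).
  rewrite a'K => H; apply: (nbhs_singleton (H _ _)).
    by near=> z; exact: aK.
  by near=> z; exact: ca.
split; last first.
  rewrite -[in LHS]fD image_comp -[RHS]image_id.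
  by apply: eq_imagel => p _; exact: homeo_funK.
exists a'; split.
  split => // [x y xy|y|y].
  - case: (ltgtP (a' x) (a' y)) => // [/ia|/(congr1 a)]; rewrite !a'K.
      by move=> /(lt_trans xy); rewrite ltxx.
    by move=> xyE; rewrite xyE ltxx in xy.
  - by rewrite -{1}(a'K y) -a1 aK.
  - by rewrite -{1}(a'K y) -faE; exact: homeo_funK.
exists (f @` A); split.
- exact: finite_image.
- by rewrite -[X in _ `<=` X]fD; exact: image_subset.
- move=> y yA.
  have [|k al] := Aaff (a' y).
    by move=> yA'; apply: yA; exists (proj (a' y)); rewrite ?faE ?a'K.
  exists (- k); near=> z.
  have : a (a' z) = a (a' y) + 2 ^ k * (a' z - a' y).
    by near: z; exact: (ca' y _ al).
  rewrite !a'K => zE; rewrite {2}zE.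
  by rewrite [y + _]addrC addrK mulrA -expfzDr// addNr expr0z mul1r [RHS]addrC subrK.
Unshelve. all: by end_near. Qed.

Definition thompsonT_pred : pred (homeo circle) :=
  [pred f | `[< is_thompsonT f >]].

Lemma thompsonT_group_closed : group_closed thompsonT_pred.
Proof.
split => [|f g]; rewrite !inE; first exact: is_thompsonT1.
by move=> fT gT; apply: is_thompsonTM => //; exact: is_thompsonTV.
Qed.

Definition thompsonT : Type := {f : homeo circle | thompsonT_pred f}.

HB.instance Definition _ := SubChoice.on thompsonT.
HB.instance Definition _ :=
  SubChoice_isSubGroup.Build (homeo circle) thompsonT_pred thompsonT
    thompsonT_group_closed.

Definition thompsonF_pred : pred thompsonT :=
  [pred f | (val f : homeo circle) (proj 0) == proj 0].

Lemma thompsonF_group_closed : group_closed thompsonF_pred.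
Proof.
split => [|f g]; rewrite !inE ?val1// => /eqP f0 /eqP g0.
rewrite valM gmulfV /= -[X in homeo_inv _ X]g0 homeo_funK.
exact/eqP.
Qed.

Definition thompsonF : Type := {f : thompsonT | thompsonF_pred f}.

HB.instance Definition _ := SubChoice.on thompsonF.
HB.instance Definition _ :=
  SubChoice_isSubGroup.Build thompsonT thompsonF_pred thompsonF
    thompsonF_group_closed.

End Thompson.

Section Amenable.
Variables (R : realType) (G : groupType).

(* Only the values of [m] on bounded functions matter: this is a left invariant
   mean on l^oo(G). *)
Definition invariant_mean (m : (G -> R) -> R) : Prop :=
  [/\ forall (a : R) (u v : G -> R), bounded_fun u -> bounded_fun v ->
        m (a *: u + v) = a * m u + m v,
      forall u : G -> R, bounded_fun u -> (forall h, 0 <= u h) -> 0 <= m u,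
      m (cst 1) = 1 &
      forall (g : G) (u : G -> R), bounded_fun u ->
        m (fun h => u (g * h)%g) = m u].

Definition amenable : Prop := exists m, invariant_mean m.

End Amenable.

Section ReducedCstar.
Variables (R : realType) (G : groupType).
Local Notation C := R[i].
Local Notation normc := (@Normc.normc R).

Definition l2_esum (xi : G -> C) : \bar R :=
  (\esum_(g in [set: G]) (normc (xi g) ^+ 2)%:E)%E.

Definition l2_pred : pred (G -> C) := [pred xi | (l2_esum xi < +oo)%E].

Lemma l2_submod_closed : submod_closed l2_pred.
Proof.
have sq0 (w : G -> C) g : (0 <= (normc (w g) ^+ 2)%:E :> \bar R)%E.
  by rewrite lee_fin sqr_ge0.
split; rewrite ?inE.
  rewrite /l2_esum esum1 ?ltry// => g _.
  by rewrite Normc.normc0 expr0n.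
move=> a u v; rewrite !inE => ufin vfin.
have le_uv g : ((normc ((a *: u + v) g) ^+ 2)%:E <=
    (2 * normc a ^+ 2)%:E * (normc (u g) ^+ 2)%:E +
    (normc (v g) ^+ 2)%:E + (normc (v g) ^+ 2)%:E :> \bar R)%E.
  rewrite -EFinM -!EFinD lee_fin -mulrA -exprMn -Normc.normcM.
  have := le_normcD (a * u g) (v g).
  have nc0 z : 0 <= normc z by case: z => ? ?; exact: sqrtr_ge0.
  set x := normc (a * u g); set y := normc (v g) => xy.
  apply: le_trans (_ : (x + y) ^+ 2 <= _).
    by rewrite ler_sqr ?nnegrE ?addr_ge0 ?nc0.
  rewrite -subr_ge0 (_ : _ - _ = (x - y) ^+ 2) ?sqr_ge0//; ring.
apply: le_lt_trans (le_esum (fun g _ => le_uv g)) _.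
have c0 : 0 <= 2 * normc a ^+ 2 by rewrite mulr_ge0// sqr_ge0.
have cu0 g : (0 <= (2 * normc a ^+ 2)%:E * (normc (u g) ^+ 2)%:E :> \bar R)%E.
  by rewrite mule_ge0 ?lee_fin ?sqr_ge0.
rewrite esumD; [|by move=> g _; rewrite adde_ge0|by move=> g _; exact: sq0].
rewrite esumD; [|by move=> g _; exact: cu0|by move=> g _; exact: sq0].
rewrite !lte_add_pinfty//.
apply: (@le_lt_trans _ _ ((2 * normc a ^+ 2)%:E * l2_esum u)%E); last first.
  by rewrite lte_mul_pinfty ?lee_fin.
apply: ge_ereal_sup => _ [X [Xfin _] <-].
rewrite -ge0_mule_fsumr//; apply: lee_wpmul2l; first by rewrite lee_fin.
by apply: esum_ge; exists X.
Qed.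

Definition l2 : Type := {xi : G -> C | l2_pred xi}.

HB.instance Definition _ := SubChoice.on l2.
HB.instance Definition _ :=
  GRing.SubChoice_isSubLmodule.Build C (G -> C) l2_pred l2 l2_submod_closed.

Definition l2norm (xi : l2) : R := Num.sqrt (fine (l2_esum (val xi))).

Lemma l2_translate_subproof (g : G) (xi : l2) :
  l2_pred (fun h => val xi (g^-1 * h)%g).
Proof.
have E : l2_esum (val xi) = l2_esum (fun h => val xi (g^-1 * h)%g).
  apply: reindex_esum; split => // [h k _ _|h _]; first exact: mulgI.
  by exists (g * h)%g => //; rewrite mulKg.
by have : (l2_esum (val xi) < +oo)%E := valP xi; rewrite E.
Qed.

Definition lreg (g : G) (xi : l2) : l2 := Sub _ (l2_translate_subproof g xi).

Definition bounded_operator (A : l2 -> l2) : Prop :=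
  linear A /\ exists M : R, forall xi, l2norm (A xi) <= M * l2norm xi.

(* The inner bound says that the operator norm of [A - B] is at most [e]. *)
Definition norm_closure (S : set (l2 -> l2)) : set (l2 -> l2) :=
  [set A | bounded_operator A /\
    forall e : R, 0 < e -> exists2 B, S B &
      forall xi, l2norm (A xi - B xi) <= e * l2norm xi].

Definition lreg_algebra : set (l2 -> l2) :=
  [set A | exists s : seq (C * G), A = \sum_(p <- s) p.1 *: lreg p.2].

Definition reduced_cstar : set (l2 -> l2) := norm_closure lreg_algebra.

(* Two-sided, and closed in the operator norm: these are the ideals meant when
   a C*-algebra is called simple. *)
Definition closed_ideal (A J : set (l2 -> l2)) : Prop :=
  [/\ J `<=` A,
      J 0 /\ (forall (c : C) S T, J S -> J T -> J (c *: S + T)),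
      forall S T, A S -> J T -> J (S \o T) /\ J (T \o S) &
      norm_closure J `<=` J].

Definition cstar_simple : Prop :=
  forall J, closed_ideal reduced_cstar J -> J = [set 0] \/ J = reduced_cstar.

End ReducedCstar.

(* Main.v *)
Require Import Defs.
From mathcomp Require Import all_boot all_order all_algebra.
From mathcomp Require Import all_classical all_reals all_analysis.
From mathcomp Require Import lra ring zify complex.
Import Order.TTheory GRing.Theory Num.Theory.
Import numFieldNormedType.Exports.

Set Implicit Arguments.
Unset Strict Implicit.
Unset Printing Implicit Defensive.

Local Open Scope classical_set_scope.
Local Open Scope ring_scope.

(** Why the three properties are equivalent.

    _Non-amenability of [F] gives C*-simplicity._ By an averaging argument of
    Powers ([powers_simple]), a group [G] is C*-simple as soon as, for finitely
    many nontrivial elements [g], the averages of the translations by the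
    conjugates [q g q^-1] over a common finite list of elements [q] have small
    norm on l^2(G). Let [G] be [F] or [T], acting on the circle, and let [g]
    move an arc [U] off itself. If [v] is supported on [U], then
    [v g v^-1 = (v . g v^-1 g^-1) g], where [g v^-1 g^-1] is supported on [g U]
    and thus commutes with everything supported on [U]. The elements supported on
    a dyadic arc [U] include a copy of [F] ([cell_embedding]), so the average
    over [v] becomes one over elements of a copy of [F x F], whose first
    components run through a list in [F]. If [F] is not amenable, then a suitable
    average in [F] contracts a positive weight on [F] pointwise. The weight pulls
    back to [G], and the Schur test turns it into a norm estimate, of geometric
    decay in the length of the words [v] ([conjugates_contract]). Finitely many
    nontrivial elements displace disjoint dyadic arcs ([displaced_cells]), and
    the averages over disjoint arcs do not disturb each other
    ([powers_averaging]).

    _C*-simplicity of [F] or [T] gives non-amenability of [F]._ If a subgroup [H]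
    of [G] is amenable, almost invariant vectors of l^2(H) show that the
    quasi-regular representation on l^2(G/H) is bounded by the regular one
    ([coset_coefficient_le]). The elements of the reduced C*-algebra that it
    annihilates form a closed ideal without the identity, so [G] is not C*-simple
    if some nonzero finite sum of translations acts as [0] on l^2(G/H)
    ([amenable_subgroup_not_simple]). For [H = G = F] the sum [1 - f] works for
    any [f] other than [1]. For [H = F] and [G = T] the coset space is the orbit
    of the base point of the circle, and [(1 - g) (1 - h)] works for [g] and [h]
    supported on complementary halves of the circle.

    _Amenability and weights._ Both directions rest on an elementary form of
    Kesten's criterion. For a finite symmetric list [S] in a group, either there
    are finite lists almost invariant under [S], or the generating series of the
    numbers of words in [S] is a weight as above ([dichotomy]). An invariant mean
    excludes such weights, because it would turn the logarithm of the weight into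
    an odd function on [S] with negative sum ([amenable_not_superharmonic]).
    Conversely, almost invariant lists for all [S] yield an invariant mean by a
    limit along an ultrafilter ([almost_invariant_amenable]). *)

(** * Counting coincidences in lists of group elements *)

Section Coincidences.
Variables (R : realType) (G : groupType).
Implicit Types (V W Y : seq G) (u : G -> R).

Definition mult W (h : G) : R := (count_mem h W)%:R.

(** The scalar product in l^2(G) of the sums of the Dirac functions along [V]
    and along [W]; a list stands for this vector throughout. *)
Definition coincidences V W : R :=
  \sum_(v <- V) \sum_(w <- W) (v == w)%:R.

Definition translate (g : G) W : seq G := [seq (g * w)%g | w <- W].

Lemma mult_ge0 W h : 0 <= mult W h.
Proof. by rewrite ler0n. Qed.

Lemma multE W h : mult W h = \sum_(w <- W) (h == w)%:R.
Proof.
rewrite /mult; elim: W => [|w W IH]; rewrite ?big_nil// big_cons -IH /=.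
by rewrite natrD eq_sym.
Qed.

Lemma mult_translate g W h : mult (translate g W) h = mult W (g^-1 * h)%g.
Proof.
rewrite /mult /translate count_map; congr (_%:R); apply: eq_count => w /=.
by apply/eqP/eqP => [<-|->]; rewrite ?mulKg ?mulVKg.
Qed.

Lemma sum_mult W Y u : uniq Y -> {subset W <= Y} ->
  \sum_(w <- W) u w = \sum_(y <- Y) mult W y * u y.
Proof.
move=> uY sWY; under [RHS]eq_bigr do rewrite multE mulr_suml.
rewrite exchange_big /= big_seq [RHS]big_seq; apply: eq_bigr => w wW.
rewrite (bigD1_seq w) ?sWY//= eqxx mul1r big1 ?addr0// => y /negPf yw.
by rewrite yw mul0r.
Qed.

Lemma coincidencesE V W Y :
  uniq Y -> {subset V <= Y} ->
  coincidences V W = \sum_(y <- Y) mult V y * mult W y.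
Proof.
move=> uY sVY; rewrite -sum_mult//; apply: eq_bigr => v _.
by rewrite multE.
Qed.

Lemma coincidences_translate g V W :
  coincidences (translate g V) (translate g W) = coincidences V W.
Proof.
rewrite /coincidences big_map; apply: eq_bigr => v _.
rewrite big_map; apply: eq_bigr => w _.
by rewrite (inj_eq (@mulgI _ g)).
Qed.

Lemma coincidences_translateV g h V W :
  coincidences (translate g V) (translate h W) =
  coincidences (translate (h^-1 * g) V) W.
Proof.
rewrite -(coincidences_translate h _ W); congr coincidences.
by rewrite /translate -map_comp; apply: eq_map => v /=; rewrite mulgA mulVKg.
Qed.

Lemma mult_sqr_le W h : mult W h ^+ 2 <= coincidences W W.
Proof.
pose Y := undup (h :: W).
rewrite (@coincidencesE _ _ Y) ?undup_uniq//; last first.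
  by move=> w wW; rewrite mem_undup inE wW orbT.
rewrite (bigD1_seq h) ?undup_uniq ?mem_undup ?inE ?eqxx//= expr2 lerDl.
by apply: sumr_ge0 => y _; rewrite mulr_ge0 ?mult_ge0.
Qed.

Lemma coincidences_gt0 W : W != [::] -> 0 < coincidences W W.
Proof.
case: W => // w W _; apply: lt_le_trans (mult_sqr_le _ w).
by rewrite exprn_gt0// ltr0n /= eqxx.
Qed.

(** Mean value inequality [2 a b <= a^2 + b^2], summed over the group: a
    translate of [W] meets [W] at most as often as [W] itself does. *)
Lemma coincidences_translate_le g W :
  coincidences (translate g W) W <= coincidences W W.
Proof.
pose Y := undup (translate g W ++ W).
have uY : uniq Y by exact: undup_uniq.
have sY1 : {subset translate g W <= Y}.
  by move=> w wW; rewrite mem_undup mem_cat wW.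
have sY2 : {subset W <= Y} by move=> w wW; rewrite mem_undup mem_cat wW orbT.
have := coincidences_translate g W W.
rewrite (coincidencesE _ uY sY1) (coincidencesE _ uY sY1).
rewrite (coincidencesE _ uY sY2) => E.
suff : 2 * \sum_(y <- Y) mult (translate g W) y * mult W y <=
  \sum_(y <- Y) mult (translate g W) y * mult (translate g W) y +
  \sum_(y <- Y) mult W y * mult W y by rewrite E; lra.
rewrite mulr_sumr -big_split /=; apply: ler_sum => y _.
by have := sqr_ge0 (mult (translate g W) y - mult W y); rewrite sqrrB; nra.
Qed.

End Coincidences.

(** * A dichotomy of Kesten type *)

Section Words.
Variables (G : groupType).

Definition symmetrization (S : seq G) : seq G :=
  1%g :: S ++ [seq (s^-1)%g | s <- S].

Lemma sum_symmetrization (V : nmodType) (S : seq G) (u : G -> V) :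
  \sum_(s <- symmetrization S) u (s^-1)%g = \sum_(s <- symmetrization S) u s.
Proof.
rewrite !big_cons !big_cat !big_map /= invg1; congr (_ + _).
by rewrite addrC; congr (_ + _); apply: eq_bigr => s _; rewrite invgK.
Qed.

Lemma symmetrizationV S s :
  s \in symmetrization S -> (s^-1)%g \in symmetrization S.
Proof.
rewrite /symmetrization !inE !mem_cat => /or3P[/eqP->|sS|/mapP[t tS ->]].
- by rewrite invg1 eqxx.
- by rewrite map_f ?orbT.
- by rewrite invgK tS orbT.
Qed.

Fixpoint words (S : seq G) (k : nat) : seq G :=
  if k is k'.+1 then [seq (s * w)%g | s <- S, w <- words S k'] else [:: 1%g].

Lemma big_words (V : nmodType) S k (u : G -> V) :
  \sum_(w <- words S k.+1) u w =
  \sum_(s <- S) \sum_(w <- words S k) u (s * w)%g.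
Proof. by rewrite big_allpairs_dep. Qed.

Lemma size_words S k : size (words S k) = (size S ^ k)%N.
Proof. by elim: k => //= k IH; rewrite size_allpairs IH expnS. Qed.

End Words.

Section Dichotomy.
Variables (R : realType) (G : groupType).
Implicit Types (S W : seq G) (e r : R).

(** The unit vector proportional to the sum of the Dirac functions along [W] is
    almost fixed by the translations by [S]. *)
Definition almost_invariant S e : Prop :=
  exists2 W : seq G, W != [::] &
    {in S, forall s, (1 - e) * coincidences R W W <=
                     coincidences R (translate s W) W}.

(** A positive weight that the averaging operator along [S] contracts
    pointwise; by the Schur test it certifies a spectral gap. *)
Definition superharmonic S (w : G -> R) r : Prop :=
  [/\ forall h, 0 < w h, 0 <= r < (size S)%:R &
      forall h, \sum_(s <- S) w (s * h)%g <= r * w h].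

Lemma mult_words S k h :
  mult R (words S k.+1) h = \sum_(s <- S) mult R (words S k) (s^-1 * h)%g.
Proof.
rewrite multE big_words; apply: eq_bigr => s _.
rewrite multE; apply: eq_bigr => w _; congr (_%:R).
by congr nat_of_bool; apply/eqP/eqP => [->|<-]; rewrite ?mulKg ?mulVKg.
Qed.

Lemma coincidences_words S k :
  coincidences R (words S k.+1) (words S k.+1) =
  \sum_(s <- S) \sum_(t <- S)
    coincidences R (translate (t^-1 * s) (words S k)) (words S k).
Proof.
rewrite /coincidences big_words; apply: eq_bigr => s _.
under eq_bigr do rewrite big_words.
rewrite exchange_big /=; apply: eq_bigr => t _.
rewrite -[RHS]/(coincidences _ _ _) -coincidences_translateV.
rewrite /coincidences big_map; apply: eq_bigr => v _.
by rewrite big_map.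
Qed.

(** The left side is a sum of [size S ^ 2] terms, indexed by pairs [(s, t)], each
    at most [coincidences] of the words of length [k]. A generator that moves
    the list of these words too far lowers the term [(s, 1)]. *)
Lemma coincidences_words_le S e :
  (1%g : G) \in S -> ~ almost_invariant S e -> forall k,
  coincidences R (words S k.+1) (words S k.+1) <=
  ((size S)%:R ^+ 2 - e) * coincidences R (words S k) (words S k).
Proof.
move=> S1 nS k; set W := words S k.
have W0 : W != [::].
  rewrite -size_eq0 size_words expn_eq0 negb_and size_eq0.
  by case: (S) S1.
have [s sS lts] : exists2 s, s \in S &
    coincidences R (translate s W) W < (1 - e) * coincidences R W W.
  apply: contrapT => H; apply: nS; exists W => // s sS.
  by rewrite leNgt; apply/negP => lts; apply: H; exists s.
rewrite coincidences_words (big_rem s)//= (big_rem 1%g)//= invg1 mul1g.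
set q := coincidences R W W in lts *.
have b1 : \sum_(t <- rem 1%g S) coincidences R (translate (t^-1 * s) W) W <=
    ((size S)%:R - 1) * q.
  apply: (@le_trans _ _ (\sum_(t <- rem 1%g S) q)).
    by apply: ler_sum => t _; exact: coincidences_translate_le.
  rewrite big_const_seq count_predT iter_addr_0 size_rem// -(mulr_natl q).
  by rewrite -subn1 natrB// lt0n size_eq0; case: (S) S1.
have b2 : \sum_(s' <- rem s S) \sum_(t <- S)
    coincidences R (translate (t^-1 * s') W) W <=
    ((size S)%:R - 1) * ((size S)%:R * q).
  apply: (@le_trans _ _ (\sum_(s' <- rem s S) \sum_(t <- S) q)).
    apply: ler_sum => s' _; apply: ler_sum => t _.
    exact: coincidences_translate_le.
  rewrite !big_const_seq !count_predT !iter_addr_0 size_rem//.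
  rewrite -(mulr_natl q) -(mulr_natl (_ * q)).
  by rewrite -subn1 natrB// lt0n size_eq0; case: (S) S1.
have := lerD (lerD (ltW lts) b1) b2.
by move/le_trans; apply; rewrite le_eqVlt; apply/orP; left; apply/eqP; ring.
Qed.

End Dichotomy.

Section DichotomyTheorem.
Variables (R : realType) (G : groupType).
Implicit Types (S W : seq G) (e r : R).

(** The weight is the generating series of the number of words; it satisfies
    [sum_s w (s^-1 h) = r (w h - delta_1 h)], and it converges because the
    square of the number of words of length [k] representing a given element
    is at most the number of pairs of equal words. *)
Lemma word_series S e : (1%g : G) \in S -> 0 < e -> ~ almost_invariant S e ->
  exists w r, [/\ forall h, 0 <= w h,
    forall k h, h \in words S k -> 0 < w h, 0 <= r < (size S)%:R &
    forall h, \sum_(s <- S) w (s^-1 * h)%g <= r * w h].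
Proof.
move=> S1 e0 nS; pose n : R := (size S)%:R; pose a := n ^+ 2 - e.
have n0 : 0 < n by rewrite ltr0n; case: (S) S1.
pose q k := coincidences R (words S k) (words S k).
have q_gt0 k : 0 < q k.
  apply: coincidences_gt0; rewrite -size_eq0 size_words expn_eq0 negb_and.
  by rewrite size_eq0; case: (S) S1.
have qS k : q k.+1 <= a * q k by exact: coincidences_words_le.
have a0 : 0 < a by rewrite -(pmulr_lgt0 _ (q_gt0 0)) (lt_le_trans _ (qS 0)).
have an : Num.sqrt a < n.
  rewrite -(ltr_pXn2r (isT : (0 < 2)%N)) ?nnegrE ?sqrtr_ge0 ?(ltW n0)//.
  by rewrite sqr_sqrtr ?(ltW a0)// gtrBl.
have qle k : q k <= a ^+ k.
  elim: k => [|k IH].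
    by rewrite /q /coincidences !big_seq1 eqxx.
  by rewrite (le_trans (qS k))// exprS ler_pM2l.
have fle k h : mult R (words S k) h <= Num.sqrt a ^+ k.
  rewrite -(ler_pXn2r (isT : (0 < 2)%N)) ?nnegrE ?exprn_ge0 ?sqrtr_ge0
    ?mult_ge0//.
  rewrite -exprM mulnC exprM sqr_sqrtr ?(ltW a0)//.
  exact: le_trans (mult_sqr_le _ _ _) (qle k).
(* The series of the [mult (words S k) h / r ^ k] is dominated by a geometric
   one as soon as [r] exceeds [sqrt a]. *)
pose r := (Num.sqrt a + n) / 2.
have r0 : 0 < r by rewrite divr_gt0// ltr_wpDl ?sqrtr_ge0.
have ar : Num.sqrt a < r by rewrite /r; lra.
have rn : r < n by rewrite /r; lra.
clearbody r.
pose u h k := mult R (words S k) h / r ^+ k.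
have u_ge0 h k : 0 <= u h k by rewrite divr_ge0 ?mult_ge0// exprn_ge0// ltW.
have u_cvg h : cvgn (series (u h)).
  apply: (@series_le_cvg _ _ (geometric 1 (Num.sqrt a / r))) => // [k|k|].
  - by rewrite /geometric/= mul1r exprn_ge0// divr_ge0 ?sqrtr_ge0// ltW.
  - by rewrite /geometric/= mul1r expr_div_n ler_pM2r ?invr_gt0 ?exprn_gt0.
  - apply: is_cvg_geometric_series.
    have ar0 : 0 <= Num.sqrt a / r by rewrite divr_ge0 ?sqrtr_ge0// ltW.
    by rewrite ger0_norm// ltr_pdivrMr ?mul1r.
have u_le h k : series (u h) k <= limn (series (u h)).
  apply: nondecreasing_cvgn_le => //; apply: nondecreasing_series => i _ _.
  exact: u_ge0.
exists (fun h => limn (series (u h))), r; split.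
- by move=> h; apply: le_trans (u_le h 0); rewrite seriesEnat /= big_nil.
- move=> k h hW; apply: lt_le_trans (u_le h k.+1).
  rewrite seriesEnat /= big_nat_recr//= ltr_wpDl ?sumr_ge0//.
  by rewrite divr_gt0 ?exprn_gt0// ltr0n -has_count has_pred1.
- by rewrite (ltW r0).
- move=> h; set l := (X in _ <= X).
  have part K : \sum_(s <- S) series (u (s^-1 * h)%g) K <= l.
    rewrite /series/= exchange_big /= /l.
    apply: le_trans (_ : r * series (u h) K.+1 <= _); last first.
      by rewrite ler_pM2l.
    rewrite /series /= big_nat_recl//= mulrDr mulr_sumr.
    rewrite ler_wpDl//; first exact: (mulr_ge0 (ltW r0) (u_ge0 h 0%N)).
    apply: ler_sum => k _.
    rewrite /u -mulr_suml -mult_words exprS invfM mulrCA (mulrA r).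
    rewrite divff ?gt_eqF//.
    by rewrite mul1r.
  have cv : (fun K => \sum_(s <- S) series (u (s^-1 * h)%g) K) @ \oo -->
            \sum_(s <- S) limn (series (u (s^-1 * h)%g)).
    elim: (S) => [|s S' IH].
      by under eq_fun do rewrite big_nil; rewrite big_nil; exact: cvg_cst.
    under eq_fun do rewrite big_cons; rewrite big_cons.
    by apply: cvgD => //; exact: u_cvg.
  rewrite -(cvg_lim _ cv)//; apply: limr_le.
    by apply/cvg_ex; eexists; exact: cv.
  by near=> K; exact: part.
Unshelve. all: by end_near. Qed.

(** The generating series vanishes outside the subgroup generated by [S]; it is
    spread over the group along representatives of the right cosets. *)
Lemma dichotomy (S : seq G) :
  (forall e, 0 < e -> almost_invariant (symmetrization S) e) \/
  exists w r, @superharmonic R G (symmetrization S) w r.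
Proof.
set T := symmetrization S.
have T1 : 1%g \in T by rewrite inE eqxx.
have [H|/existsNP[e]] := pselect (forall e, 0 < e -> almost_invariant T e).
  by left.
move=> /not_implyP[e0 nT]; right.
have [w [r [w0 wW r0 wr]]] := word_series T1 e0 nT.
pose span : set G := [set h | exists k, h \in words T k].
have spanM s h : s \in T -> span (s * h)%g <-> span h.
  move=> sT; split => -[k hk].
    exists k.+1; rewrite -(mulKg s h); apply/allpairsP.
    by exists (s^-1, (s * h))%g; split => //; exact: symmetrizationV.
  by exists k.+1; apply/allpairsP; exists (s, h).
(* [h (rep h)^-1] is in the span of [S], where the series is positive. *)
pose rep h := xget 1%g [set y | span (h * y^-1)%g].
have repM s h : s \in T -> rep (s * h)%g = rep h.
  move=> sT; congr xget; apply/funext => y; apply/propext => /=.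
  by rewrite -mulgA spanM.
have repP h : span (h * (rep h)^-1)%g.
  rewrite /rep; case: xgetP => [y -> //|/(_ h)]; case.
  by exists 0%N; rewrite mulgV inE.
exists (fun h => w (h * (rep h)^-1)%g), r; split => // h.
  by have [k] := repP h; exact: wW.
apply: le_trans (wr _).
rewrite -(@sum_symmetrization _ _ S (fun s => w (s^-1 * _)%g)).
rewrite big_seq [leRHS]big_seq; apply: ler_sum => s sT.
by rewrite invgK repM// mulgA.
Qed.

End DichotomyTheorem.

(** * Amenability and almost invariant lists *)

Lemma bounded_funP (T : Type) (R : realType) (u : T -> R) :
  bounded_fun u <-> exists M : R, forall x, `|u x| <= M.
Proof.
split => [[M [_ H]]|[M H]].
  by exists (M + 1) => x; apply: (H (M + 1)) => //; rewrite ltrDl.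
exists M; split; rewrite ?num_real// => N MN x _.
exact: le_trans (H x) (ltW MN).
Qed.

Section Means.
Variables (R : realType) (G : groupType) (m : (G -> R) -> R).
Hypothesis mm : invariant_mean m.
Implicit Types u v : G -> R.

Lemma boundedD u v : bounded_fun u -> bounded_fun v -> bounded_fun (u + v).
Proof.
move=> /bounded_funP[M HM] /bounded_funP[N HN]; apply/bounded_funP.
exists (M + N) => x; apply: le_trans (ler_normD _ _) _; exact: lerD.
Qed.

Lemma boundedN u : bounded_fun u -> bounded_fun (- u).
Proof.
move=> /bounded_funP[M HM]; apply/bounded_funP; exists M => x.
by rewrite /GRing.opp/= normrN.
Qed.

Lemma bounded_cst (c : R) : bounded_fun (cst c : G -> R).
Proof. by apply/bounded_funP; exists `|c|. Qed.

Lemma meanD u v : bounded_fun u -> bounded_fun v -> m (u + v) = m u + m v.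
Proof.
by move=> bu bv; case: mm => /(_ 1 u v bu bv) + _ _ _; rewrite scale1r mul1r.
Qed.

Lemma mean0 : m 0 = 0.
Proof.
by have := meanD (bounded_cst 0) (bounded_cst 0); rewrite addr0; lra.
Qed.

Lemma meanN u : bounded_fun u -> m (- u) = - m u.
Proof.
by move=> bu; have := meanD bu (boundedN bu); rewrite subrr mean0; lra.
Qed.

Lemma mean_cst c : m (cst c) = c.
Proof.
case: mm => /(_ c (cst 1) 0 (bounded_cst 1) (bounded_cst 0)) + _ m1 _.
rewrite m1 mean0 mulr1 !addr0 => E; rewrite -[RHS]E; congr m.
by apply/funext => x; rewrite /cst/= -[LHS]mulr1.
Qed.

Lemma mean_le u v : bounded_fun u -> bounded_fun v ->
  (forall h, u h <= v h) -> m u <= m v.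
Proof.
move=> bu bv uv; case: mm => _ /(_ (v - u)) + _ _.
rewrite meanD ?meanN//; last exact: boundedN.
rewrite subr_ge0; apply; first by apply: boundedD => //; exact: boundedN.
by move=> h; rewrite subr_ge0.
Qed.

Lemma mean_sum (I : eqType) (s : seq I) (u : I -> G -> R) :
  {in s, forall i, bounded_fun (u i)} ->
  bounded_fun (\sum_(i <- s) u i) /\
  m (\sum_(i <- s) u i) = \sum_(i <- s) m (u i).
Proof.
elim: s => [|i s IH] bu; first by rewrite !big_nil mean0; split => //;
  exact: bounded_cst.
have [|b e] := IH; first by move=> j js; apply: bu; rewrite inE js orbT.
have bi : bounded_fun (u i) by apply: bu; rewrite inE eqxx.
by rewrite !big_cons meanD// e; split => //; exact: boundedD.
Qed.

End Means.

Section AmenableDichotomy.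
Variables (R : realType) (G : groupType).

(** The mean of [ln (w (s h)) - ln (w h)] is odd in [s] by invariance, hence
    sums to [0] over a symmetric list; but [ln x <= x - 1] bounds the sum of
    these functions by the negative constant [r - size S]. *)
Lemma amenable_not_superharmonic (S : seq G) (w : G -> R) (r : R) :
  amenable R G -> ~ superharmonic (symmetrization S) w r.
Proof.
move=> [m mm] [w0 /andP[r0 rS] wr]; set T := symmetrization S in rS wr.
have wT s h : s \in T -> w (s * h)%g <= r * w h.
  move=> sT; apply: le_trans (wr h); rewrite (big_rem s)//= lerDl.
  by apply: sumr_ge0 => t _; exact/ltW.
have r_gt0 : 0 < r.
  by rewrite -(pmulr_lgt0 _ (w0 1%g)) (lt_le_trans _ (wT 1%g 1%g _)) ?inE ?eqxx.
pose c s h := ln (w (s * h)%g) - ln (w h).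
have cb s : s \in T -> bounded_fun (c s).
  move=> sT; apply/bounded_funP; exists (ln r) => h.
  rewrite /c ler_norml lerBlDr -lnM ?posrE// ler_ln ?posrE ?mulr_gt0//.
  rewrite wT// andbT lerBrDl lerBlDr -lnM ?posrE// mulrC.
  rewrite ler_ln ?posrE ?mulr_gt0//.
  by rewrite -{1}(mulKg s h) wT// symmetrizationV.
have cV s : s \in T -> m (c (s^-1)%g) = - m (c s).
  move=> sT; rewrite -meanN//; last exact: cb.
  case: mm => _ _ _ mI; rewrite -(mI s); last first.
    by apply: cb; exact: symmetrizationV.
  congr m; apply/funext => h; rewrite /c mulKg.
  by rewrite /GRing.opp/= opprB.
have c0 : \sum_(s <- T) m (c s) = 0.
  have : \sum_(s <- T) m (c s) = - \sum_(s <- T) m (c s).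
    rewrite -[LHS](@sum_symmetrization _ _ S (fun s => m (c s))) -sumrN.
    by rewrite big_seq [RHS]big_seq; apply: eq_bigr => s; exact: cV.
  by lra.
have [bc mc] := mean_sum mm cb.
have : m (\sum_(s <- T) c s) <= m (cst (r - (size T)%:R)).
  apply: (mean_le mm) => // [|h]; first exact: bounded_cst.
  rewrite fct_sumE /=.
  apply: (@le_trans _ _ (\sum_(s <- T) (w (s * h)%g / w h - 1))).
    apply: ler_sum => s _; rewrite /c -ln_div ?posrE//.
    have p : 0 < w (s * h)%g / w h by rewrite divr_gt0.
    have := @le_ln1Dx _ (w (s * h)%g / w h - 1).
    by rewrite subrKC ltrBrDr addNr => /(_ p).
  rewrite big_split /= -mulr_suml sumrN lerB//; last first.
    by rewrite big_const_seq count_predT iter_addr_0.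
  by rewrite ler_pdivrMr.
by rewrite mc c0 mean_cst// subr_ge0 leNgt rS.
Qed.

Lemma amenable_almost_invariant (S : seq G) (e : R) :
  amenable R G -> 0 < e -> almost_invariant (symmetrization S) e.
Proof.
move=> aG e0; have [H|[w [r wr]]] := dichotomy R S; first exact: H.
by have := amenable_not_superharmonic aG wr.
Qed.

End AmenableDichotomy.

Section MeanFromLists.
Variables (R : realType) (G : groupType).
Implicit Types (S W : seq G) (u v : G -> R).

(** The vector state on l^oo(G) of the unit vector proportional to the sum of
    the Dirac functions along [W]. *)
Definition list_mean W u : R :=
  (\sum_(w <- W) mult R W w * u w) / coincidences R W W.

Lemma coincidences_sum_mult V W :
  coincidences R V W = \sum_(v <- V) mult R W v.
Proof. by apply: eq_bigr => v _; rewrite multE. Qed.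

Lemma list_mean_le W u M :
  (forall h, `|u h| <= M) -> `|list_mean W u| <= M.
Proof.
move=> uM; have M0 : 0 <= M by exact: le_trans (normr_ge0 _) (uM 1%g).
have [->|W0] := eqVneq W [::].
  by rewrite /list_mean big_nil mul0r normr0.
have q0 := coincidences_gt0 R W0.
rewrite normrM normfV (gtr0_norm q0) ler_pdivrMr//.
rewrite [in leRHS]coincidences_sum_mult mulr_sumr.
apply: le_trans (ler_norm_sum _ _ _) _; apply: ler_sum => w _.
by rewrite normrM ger0_norm ?mult_ge0// mulrC ler_wpM2r ?mult_ge0.
Qed.

(** With [c] and [c'] the multiplicities along [W] and its translate, the
    difference of the means is proportional to the sum of [(c' ^ 2 - c ^ 2) u],
    and [|c' ^ 2 - c ^ 2|] is at most half of
    [(c' - c) ^ 2 / d + d (c' + c) ^ 2]. *)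
Lemma list_mean_translate W u M g d :
  W != [::] -> (forall h, `|u h| <= M) -> 0 < d ->
  (1 - d ^+ 2) * coincidences R W W <= coincidences R (translate g W) W ->
  `|list_mean W (fun h => u (g * h)%g) - list_mean W u| <= 3 * d * M.
Proof.
move=> W0 uM d0 ai; have M0 : 0 <= M by exact: le_trans (normr_ge0 _) (uM 1%g).
have q0 := coincidences_gt0 R W0.
pose Y := undup (translate g W ++ W).
have uY : uniq Y by exact: undup_uniq.
have sY1 : {subset translate g W <= Y}.
  by move=> w wW; rewrite mem_undup mem_cat wW.
have sY2 : {subset W <= Y} by move=> w wW; rewrite mem_undup mem_cat wW orbT.
pose c' := mult R (translate g W); pose c := mult R W.
have e1 : \sum_(y <- Y) c y * c y = coincidences R W W.
  by rewrite -coincidencesE.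
have e2 : \sum_(y <- Y) c' y * c' y = coincidences R W W.
  by rewrite -coincidencesE// coincidences_translate.
have e3 : \sum_(y <- Y) c' y * c y = coincidences R (translate g W) W.
  by rewrite -coincidencesE.
rewrite /list_mean -mulrBl normrM normfV (gtr0_norm q0) ler_pdivrMr//.
have -> : \sum_(w <- W) c w * u (g * w)%g = \sum_(y <- Y) c' y * (c' y * u y).
  rewrite -(@sum_mult _ _ (translate g W))// big_map.
  by apply: eq_bigr => w _; rewrite /c' mult_translate mulKg.
rewrite (@sum_mult _ _ W Y)// -sumrB.
apply: le_trans (ler_norm_sum _ _ _) _.
apply: (@le_trans _ _ (\sum_(y <- Y) M *
    ((d^-1 / 2) * (c' y - c y) ^+ 2 + (d / 2) * (c' y + c y) ^+ 2))).
  apply: ler_sum => y _.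
  rewrite !mulrA -mulrBl normrM mulrC ler_pM//.
  have -> : c' y * c' y - mult R W y * mult R W y =
    (c' y - c y) * (c' y + c y) by rewrite /c; ring.
  set a := c' y - c y; set b := c' y + c y.
  rewrite ler_norml; apply/andP; split; rewrite -subr_ge0.
    have -> : a * b - - (d^-1 / 2 * a * a + d / 2 * b * b) =
      d^-1 / 2 * (a + d * b) ^+ 2 by field; rewrite gt_eqF.
    by rewrite mulr_ge0 ?sqr_ge0// divr_ge0// invr_ge0 ltW.
  have -> : d^-1 / 2 * a * a + d / 2 * b * b - a * b =
    d^-1 / 2 * (a - d * b) ^+ 2 by field; rewrite gt_eqF.
  by rewrite mulr_ge0 ?sqr_ge0// divr_ge0// invr_ge0 ltW.
rewrite -mulr_sumr big_split /= -!mulr_sumr.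
have -> : \sum_(y <- Y) (c' y - c y) ^+ 2 = 2 * (coincidences R W W -
    coincidences R (translate g W) W).
  transitivity (\sum_(y <- Y) (c' y * c' y + c y * c y - 2 * (c' y * c y))).
    by apply: eq_bigr => y _; ring.
  by rewrite sumrB big_split /= -mulr_sumr e1 e2 e3; ring.
have -> : \sum_(y <- Y) (c' y + c y) ^+ 2 = 2 * (coincidences R W W +
    coincidences R (translate g W) W).
  transitivity (\sum_(y <- Y) (c' y * c' y + c y * c y + 2 * (c' y * c y))).
    by apply: eq_bigr => y _; ring.
  by rewrite big_split big_split /= -mulr_sumr e1 e2 e3; ring.
rewrite [leRHS]mulrAC [leRHS]mulrC ler_wpM2l//.
have nle := coincidences_translate_le R g W.
move: ai q0 nle; set q := coincidences R W W.
set n := coincidences R (translate g W) W => ai q0 nle.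
have : d^-1 / 2 * (2 * (q - n)) <= d * q.
  rewrite mulrA divfK// mulrC ler_pdivrMr//.
  by move: ai; rewrite mulrBl mul1r lerBlDr -lerBlDl expr2 mulrAC.
have : d / 2 * (2 * (q + n)) <= d * (2 * q).
  by rewrite mulrA divfK// ler_pM2l//; lra.
by lra.
Qed.

(** The mean is the limit of the [list_mean W] along an ultrafilter that contains
    all sets of lists almost invariant under a given [S] up to a given [e]. *)
Lemma almost_invariant_amenable :
  (forall S (e : R), 0 < e -> almost_invariant (symmetrization S) e) ->
  amenable R G.
Proof.
move=> ai.
pose D : set (seq G * R) := [set p | 0 < p.2].
pose B (p : seq G * R) : set (seq G) := [set W | W != [::] /\
  {in p.1, forall s, (1 - p.2) * coincidences R W W <=
                     coincidences R (translate s W) W}].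
have FF : Filter (filter_from D B).
  apply: filter_from_filter; first by exists ([::], 1); exact: ltr01.
  move=> [S1 e1] [S2 e2] /= p1 p2; exists (S1 ++ S2, Num.min e1 e2).
    by rewrite /D/= lt_min p1 p2.
  move=> W [/= W0 H].
  split; split => // s sS; (apply: le_trans (H s _); last
    by rewrite mem_cat sS ?orbT);
    rewrite ler_pM2r ?coincidences_gt0// lerD2l lerN2.
  - by rewrite ge_min lexx.
  - by rewrite ge_min lexx orbT.
have PF : ProperFilter (filter_from D B).
  apply: filter_from_proper => -[S e] /= e0.
  have [W W0 H] := ai S e e0; exists W; split => // s sS; apply: H.
  by rewrite inE mem_cat sS orbT.
have [U [UU FU]] := ultraFilterLemma PF.
have lm_cvg u : bounded_fun u -> cvg (list_mean W u @[W --> U]).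
  move=> /bounded_funP[M uM].
  have UM : U ((fun W => list_mean W u) @^-1` `[- M, M]).
    by apply: filterE => W /=; rewrite in_itv/= -ler_norml; exact: list_mean_le.
  have [p [_ clp]] := @segment_compact R (- M) M (list_mean W u @[W --> U]) _ UM.
  apply/cvg_ex; exists p => A pA.
  have [//|nA] := in_ultra_setVsetC ((fun W => list_mean W u) @^-1` A) UU.
  by have [x []] := clp (~` A) A nA pA.
pose m u : R := lim (list_mean W u @[W --> U]).
exists m; split.
- move=> a u v bu bv; apply: cvg_lim => //.
  have -> : list_mean ^~ (a *: u + v) =
            (fun W => a * list_mean W u + list_mean W v).
    apply/funext => W; rewrite /list_mean mulrA -mulrDl; congr (_ / _).
    rewrite mulr_sumr -big_split; apply: eq_bigr => w _ /=.
    rewrite /GRing.add/= /GRing.scale/=.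
    by rewrite mulrDr mulrCA.
  by apply: cvgD; [apply: cvgMl_tmp|]; exact: lm_cvg.
- move=> u bu u0; apply: limr_ge; first exact: lm_cvg.
  near=> W; rewrite /list_mean divr_ge0//.
    by apply: sumr_ge0 => w _; rewrite mulr_ge0// mult_ge0.
  by rewrite coincidences_sum_mult; apply: sumr_ge0 => w _; exact: mult_ge0.
- apply: cvg_lim => //; apply: cvg_near_cst; apply: FU.
  exists ([::], 1); first exact: ltr01.
  move=> W [W0 _]; rewrite /= /list_mean coincidences_sum_mult.
  under eq_bigr do rewrite mulr1.
  by rewrite divff// -coincidences_sum_mult gt_eqF// coincidences_gt0.
- move=> g u bu; apply: cvg_lim => //.
  have /bounded_funP[M uM] := bu.
  have z : (fun W => list_mean W (fun h => u (g * h)%g) - list_mean W u) @ U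
      --> (0 : R).
    apply/cvgr0Pnorm_le => e e0; apply: FU.
    have M0 : 0 < M + 1 by have := le_trans (normr_ge0 _) (uM 1%g); lra.
    have M1 : 0 < 3 * (M + 1) by rewrite mulr_gt0.
    have d0 : 0 < e / (3 * (M + 1)) by rewrite divr_gt0.
    exists ([:: g], (e / (3 * (M + 1))) ^+ 2); first by rewrite /D/= exprn_gt0.
    move=> W [/= W0 H]; have /= := H g (mem_head _ _).
    move=> /(list_mean_translate W0 uM d0) /le_trans; apply.
    have -> : 3 * (e / (3 * (M + 1))) * M = e * (M / (M + 1)).
      by field; rewrite gt_eqF.
    by rewrite ler_piMr ?(ltW e0)// ler_pdivrMr// mul1r; lra.
  rewrite (_ : (fun W => _) = (fun W => list_mean W (fun h => u (g * h)%g) -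
      list_mean W u + list_mean W u)); last by apply/funext => W; rewrite subrK.
  by rewrite -[m u]add0r; apply: cvgD => //; exact: lm_cvg.
Unshelve. all: by end_near. Qed.

End MeanFromLists.

(** * Square-summable functions through finite sums *)

Lemma cauchy_schwarz (R : realType) (I : eqType) (s : seq I) (x y : I -> R)
    (a b : R) : 0 <= a -> 0 <= b ->
  \sum_(i <- s) x i ^+ 2 <= a ^+ 2 -> \sum_(i <- s) y i ^+ 2 <= b ^+ 2 ->
  \sum_(i <- s) x i * y i <= a * b.
Proof.
have zero (u v : I -> R) :
    \sum_(i <- s) u i ^+ 2 <= 0 -> \sum_(i <- s) u i * v i = 0.
  move=> u0; have : \sum_(i <- s) u i ^+ 2 == 0.
    by rewrite eq_le u0 sumr_ge0// => i _; exact: sqr_ge0.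
  rewrite psumr_eq0 => [/allP H|i _]; last exact: sqr_ge0.
  rewrite big_seq big1// => i /H /=; rewrite sqrf_eq0 => /eqP ->.
  by rewrite mul0r.
rewrite le_eqVlt => /predU1P[<-|a0].
  by move=> _; rewrite expr0n => /zero -> _; rewrite mul0r.
rewrite le_eqVlt => /predU1P[<- _|b0 xa yb].
  by rewrite expr0n => /zero H; under eq_bigr do rewrite mulrC; rewrite H mulr0.
have t0 : 0 < b / a by rewrite divr_gt0.
suff : 2 * \sum_(i <- s) x i * y i <= b / a * a ^+ 2 + a / b * b ^+ 2.
  rewrite !expr2 !mulrA !divfK ?gt_eqF//; lra.
apply: (@le_trans _ _ (b / a * \sum_(i <- s) x i ^+ 2 +
                       a / b * \sum_(i <- s) y i ^+ 2)).
  rewrite !mulr_sumr -big_split; apply: ler_sum => i _ /=; rewrite -subr_ge0.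
  have -> : b / a * x i ^+ 2 + a / b * y i ^+ 2 - 2 * (x i * y i) =
    a / b * (b / a * x i - y i) ^+ 2 by field; rewrite !gt_eqF.
  by rewrite mulr_ge0 ?sqr_ge0// divr_ge0// ltW.
by rewrite lerD// ler_pM2l// divr_gt0.
Qed.

Section L2.
Variables (R : realType) (G : groupType).
Local Notation C := R[i].
Local Notation normc := (@Normc.normc R).
Local Notation l2 := (l2 R G).
Implicit Types (xi eta : l2) (Y : seq G).

Lemma normc_ge0 (z : C) : 0 <= normc z.
Proof. by case: z => ? ?; exact: sqrtr_ge0. Qed.

Lemma ler_normcD (x y : C) : normc (x + y) <= normc x + normc y.
Proof. exact: le_normcD. Qed.

Lemma ler_normc_sum (I : Type) (s : seq I) (F : I -> C) :
  normc (\sum_(i <- s) F i) <= \sum_(i <- s) normc (F i).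
Proof.
elim: s => [|i s IH]; first by rewrite !big_nil Normc.normc0.
by rewrite !big_cons (le_trans (ler_normcD _ _))// lerD2l.
Qed.

Lemma normc_opp (z : C) : normc (- z) = normc z.
Proof. exact: normcN. Qed.

Lemma normc_real (r : R) : normc r%:C%C = `|r|.
Proof. by rewrite /Normc.normc/= expr0n addr0 sqrtr_sqr. Qed.

Lemma l2norm_ge0 xi : 0 <= l2norm xi.
Proof. exact: sqrtr_ge0. Qed.

Lemma l2_esumE xi : l2_esum (val xi) = (l2norm xi ^+ 2)%:E.
Proof.
have ge0 : (0 <= l2_esum (val xi))%E.
  by apply: esum_ge0 => g _; rewrite lee_fin sqr_ge0.
have lt : (l2_esum (val xi) < +oo)%E := valP xi.
by rewrite /l2norm sqr_sqrtr ?fine_ge0// fineK// ge0_fin_numE.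
Qed.

Lemma l2_sum_le xi Y : uniq Y ->
  \sum_(y <- Y) normc (val xi y) ^+ 2 <= l2norm xi ^+ 2.
Proof.
move=> uY; rewrite -lee_fin -l2_esumE -sumEFin; apply: esum_ge.
by exists [set` Y]; [split => //; exact: finite_seq|rewrite fsbig_seq].
Qed.

Lemma l2norm_le xi (M : R) : 0 <= M ->
  (forall Y, uniq Y -> \sum_(y <- Y) normc (val xi y) ^+ 2 <= M ^+ 2) ->
  l2norm xi <= M.
Proof.
move=> M0 H; rewrite -(ler_pXn2r (isT : (0 < 2)%N)) ?nnegrE ?l2norm_ge0//.
rewrite -lee_fin -l2_esumE; apply: ge_ereal_sup => _ [A [Afin _] <-].
by rewrite fsbig_finite// sumEFin lee_fin; apply: H; exact: finmap.fset_uniq.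
Qed.

Lemma l2_coef_le xi y : normc (val xi y) <= l2norm xi.
Proof.
rewrite -(ler_pXn2r (isT : (0 < 2)%N)) ?nnegrE ?l2norm_ge0 ?normc_ge0//.
by have := @l2_sum_le xi [:: y] isT; rewrite big_seq1.
Qed.

Lemma l2_val_sum (I : Type) (s : seq I) (F : I -> l2) y :
  val (\sum_(i <- s) F i) y = \sum_(i <- s) val (F i) y.
Proof. by rewrite raddf_sum fct_sumE. Qed.

Lemma l2_valD xi eta y : val (xi + eta) y = val xi y + val eta y.
Proof. by []. Qed.

Lemma l2_valB xi eta y : val (xi - eta) y = val xi y - val eta y.
Proof. by []. Qed.

Lemma l2_valZ c xi y : val (c *: xi) y = c * val xi y.
Proof. by []. Qed.

Lemma l2norm0_eq0 xi : l2norm xi <= 0 -> xi = 0.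
Proof.
move=> x0; apply/val_inj/funext => y; apply: Normc.eq0_normc.
by apply/eqP; rewrite eq_le normc_ge0 (le_trans (l2_coef_le _ _)).
Qed.

Lemma l2norm_triangle xi eta : l2norm (xi + eta) <= l2norm xi + l2norm eta.
Proof.
apply: l2norm_le => [|Y uY]; first by rewrite addr_ge0// l2norm_ge0.
apply: (@le_trans _ _
    (\sum_(y <- Y) (normc (val xi y) + normc (val eta y)) ^+ 2)).
  apply: ler_sum => y _; rewrite ler_pXn2r ?nnegrE ?addr_ge0 ?normc_ge0//.
  exact: ler_normcD.
under eq_bigr do rewrite sqrrD -mulr_natl.
rewrite !big_split /= -mulr_sumr.
have := cauchy_schwarz (l2norm_ge0 xi) (l2norm_ge0 eta) (l2_sum_le xi uY)
  (l2_sum_le eta uY).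
by have := l2_sum_le xi uY; have := l2_sum_le eta uY; nra.
Qed.

Lemma l2normZ_le c xi : l2norm (c *: xi) <= normc c * l2norm xi.
Proof.
apply: l2norm_le => [|Y uY]; first by rewrite mulr_ge0 ?normc_ge0 ?l2norm_ge0.
rewrite exprMn; apply: le_trans (_ : normc c ^+ 2 *
  \sum_(y <- Y) normc (val xi y) ^+ 2 <= _); last first.
  by rewrite ler_wpM2l ?sqr_ge0// l2_sum_le.
rewrite mulr_sumr; apply: ler_sum => y _.
by rewrite l2_valZ Normc.normcM exprMn.
Qed.

Lemma l2norm0 : l2norm (0 : l2) = 0.
Proof.
apply/eqP; rewrite eq_le l2norm_ge0 andbT.
by have := l2normZ_le 0 0; rewrite scaler0 Normc.normc0 mul0r.
Qed.

Lemma l2normN xi : l2norm (- xi) = l2norm xi.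
Proof.
have le eta : l2norm (- eta) <= l2norm eta.
  rewrite -scaleN1r; apply: (le_trans (l2normZ_le _ _)).
  by rewrite normc_opp Normc.normc1 mul1r.
by apply/eqP; rewrite eq_le le -{1}(opprK xi) le.
Qed.

Lemma l2norm_distC xi eta : l2norm (xi - eta) = l2norm (eta - xi).
Proof. by rewrite -l2normN opprB. Qed.

Lemma l2norm_sum (I : Type) (s : seq I) (F : I -> l2) :
  l2norm (\sum_(i <- s) F i) <= \sum_(i <- s) l2norm (F i).
Proof.
elim: s => [|i s IH]; first by rewrite !big_nil l2norm0.
by rewrite !big_cons (le_trans (l2norm_triangle _ _))// lerD2l.
Qed.

Lemma translation_val g xi y : val (lreg g xi) y = val xi (g^-1 * y)%g.
Proof. by []. Qed.

Lemma translationZD g c xi eta :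
  lreg g (c *: xi + eta) = c *: lreg g xi + lreg g eta.
Proof. exact: val_inj. Qed.

Lemma translationM g h xi : lreg (g * h)%g xi = lreg g (lreg h xi).
Proof. by apply/val_inj/funext => y; rewrite !translation_val invgM mulgA. Qed.

Lemma translation1 xi : lreg 1%g xi = xi.
Proof. by apply/val_inj/funext => y; rewrite !translation_val invg1 mul1g. Qed.

Lemma l2norm_lreg g xi : l2norm (lreg g xi) = l2norm xi.
Proof.
have le h eta : l2norm (lreg h eta) <= l2norm eta.
  apply: l2norm_le => [|Y uY]; first exact: l2norm_ge0.
  have := @l2_sum_le eta [seq (h^-1 * y)%g | y <- Y].
  by rewrite map_inj_uniq ?big_map; [apply|exact: mulgI].
apply/eqP; rewrite eq_le le /=.
by rewrite -{1}(translation1 xi) -(mulVg g) translationM le.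
Qed.

Lemma dirac_subproof (g : G) : @l2_pred R G (fun h => (h == g)%:R).
Proof.
rewrite /l2_pred /= /l2_esum (esumID [set g]); last first.
  by move=> h _; rewrite lee_fin sqr_ge0.
rewrite [X in (_ + X)%E]esum1 => [|h [_ /= hg]]; last first.
  have /negPf -> : h != g by exact/eqP.
  by rewrite Normc.normc0 expr0n.
rewrite setTI esum_set1 ?lee_fin ?sqr_ge0//.
by rewrite eqxx Normc.normc1 expr1n adde0 ltry.
Qed.

Definition dirac (g : G) : l2 := Sub _ (dirac_subproof g).

Lemma dirac_val g y : val (dirac g) y = (y == g)%:R.
Proof. by []. Qed.

Lemma translation_dirac g h : lreg g (dirac h) = dirac (g * h)%g.
Proof.
apply/val_inj/funext => y; rewrite translation_val !dirac_val; congr (_ %:R).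
by congr nat_of_bool; apply/eqP/eqP => [<-|->]; rewrite ?mulKg ?mulVKg.
Qed.

Lemma l2norm_dirac g : l2norm (dirac g) <= 1.
Proof.
apply: l2norm_le => // Y uY; rewrite expr1n.
have [gY|gY] := boolP (g \in Y).
  rewrite (bigD1_seq g)//= big1 => [|y /negPf yg].
    by rewrite eqxx Normc.normc1 expr1n addr0.
  by rewrite yg Normc.normc0 expr0n.
rewrite big_seq big1// => y yY; rewrite dirac_val.
by have [yg|] := eqVneq y g; [rewrite -yg yY in gY|rewrite Normc.normc0 expr0n].
Qed.

(** A finite sum close to the square of the norm leaves a small tail. *)
Lemma l2_truncation xi (e : R) : 0 < e -> exists Y : seq G,
  l2norm (xi - \sum_(y <- Y) val xi y *: dirac y) <= e.
Proof.
move=> e0; pose N2 := l2norm xi ^+ 2.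
have [||_ [A [Afin _] <-]] := @ub_ereal_sup_adherent R
    [set (\sum_(x \in A) (normc (val xi x) ^+ 2)%:E)%E | A in fsets [set: G]]
    (e ^+ 2) _ _.
- by rewrite exprn_gt0.
- by rewrite -[ereal_sup _]/(l2_esum (val xi)) l2_esumE.
rewrite -[ereal_sup _]/(l2_esum (val xi)) l2_esumE fsbig_finite//.
rewrite sumEFin -EFinB lte_fin; set Y := finmap.enum_fset _ => lt.
have uY : uniq Y by exact: finmap.fset_uniq.
exists Y; apply: l2norm_le (ltW e0) _ => Y' uY'.
have vE y : val (xi - \sum_(y <- Y) val xi y *: dirac y) y =
    if y \in Y then 0 else val xi y.
  rewrite l2_valD -scaleN1r l2_valZ mulN1r l2_val_sum; case: ifPn => yY.
    rewrite (bigD1_seq y)// l2_valZ dirac_val eqxx mulr1 big1 => [|z /negPf zy].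
      by rewrite /= addr0 subrr.
    by rewrite l2_valZ dirac_val eq_sym zy mulr0.
  rewrite big_seq big1 ?subr0// => z zY; rewrite l2_valZ dirac_val.
  by have [yz|_] := eqVneq y z; [rewrite -yz (negPf yY) in zY|rewrite mulr0].
apply: (@le_trans _ _ (\sum_(i <- Y' | i \notin Y) normc (val xi i) ^+ 2)).
  rewrite [leRHS]big_mkcond; apply: ler_sum => y _; rewrite vE.
  by case: ifP; rewrite ?Normc.normc0 ?expr0n.
have : uniq (Y ++ [seq y <- Y' | y \notin Y]).
  rewrite cat_uniq uY filter_uniq// andbT /=.
  by apply/hasPn => y; rewrite mem_filter => /andP[].
by move=> /(l2_sum_le xi); rewrite big_cat big_filter /=; lra.
Qed.

End L2.

(** * The Schur test and free commuting translates *)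

Lemma sum_le_subset (R : realType) (T : eqType) (Y Z : seq T) (u : T -> R) :
  uniq Y -> uniq Z -> {subset Y <= Z} -> (forall z, 0 <= u z) ->
  \sum_(y <- Y) u y <= \sum_(z <- Z) u z.
Proof.
move=> uY uZ sYZ u0.
have -> : \sum_(y <- Y) u y = \sum_(z <- Z | z \in Y) u z.
  rewrite -[RHS]big_filter; apply: perm_big; apply: uniq_perm => //.
    exact: filter_uniq.
  by move=> y; rewrite mem_filter; case: (boolP (y \in Y)) => //= /sYZ ->.
by rewrite big_mkcond; apply: ler_sum => z _; case: ifP.
Qed.

Section Schur.
Variables (R : realType) (G : groupType).
Local Notation normc := (@Normc.normc R).

(** Cauchy-Schwarz with weights: [(sum n)^2 <= (sum W) (sum n^2 / W)]; the first
    hypothesis bounds the first factor, and after exchanging the sums the second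
    one bounds what is left. *)
Lemma schur_test (U : seq G) (W : G -> R) (c : R) :
  (forall x, 0 < W x) -> 0 <= c ->
  (forall x, \sum_(u <- U) W (u^-1 * x)%g <= c * W x) ->
  (forall x, \sum_(u <- U) W (u * x)%g <= c * W x) ->
  forall xi : l2 R G, l2norm (\sum_(u <- U) lreg u xi) <= c * l2norm xi.
Proof.
move=> W0 c0 WV WU xi.
apply: l2norm_le => [|Y uY]; first by rewrite mulr_ge0 ?l2norm_ge0.
pose n x := normc (val xi x).
pose f u z := W (u * z)%g * (n z ^+ 2 / W z).
have f0 u z : 0 <= f u z.
  by rewrite mulr_ge0 ?divr_ge0 ?sqr_ge0// ltW.
pose Z := undup [seq (u^-1 * y)%g | u <- U, y <- Y].
apply: (@le_trans _ _ (\sum_(y <- Y) c * \sum_(u <- U) f u (u^-1 * y)%g)).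
  apply: ler_sum => y _.
  pose B := \sum_(u <- U) n (u^-1 * y)%g ^+ 2 / W (u^-1 * y)%g.
  have B0 : 0 <= B.
    by apply: sumr_ge0 => u _; rewrite divr_ge0 ?sqr_ge0// ltW.
  have -> : c * \sum_(u <- U) f u (u^-1 * y)%g = c * W y * B.
    rewrite -mulrA; congr (_ * _); rewrite mulr_sumr.
    by apply: eq_bigr => u _; rewrite /f mulVKg.
  have cW0 : 0 <= c * W y by rewrite mulr_ge0// ltW.
  rewrite -(sqr_sqrtr cW0) -(sqr_sqrtr B0) -exprMn.
  rewrite ler_pXn2r ?nnegrE ?normc_ge0 ?mulr_ge0 ?sqrtr_ge0//.
  rewrite l2_val_sum; apply: le_trans (ler_normc_sum _ _) _.
  apply: (@le_trans _ _ (\sum_(u <- U) Num.sqrt (W (u^-1 * y)%g) *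
      (n (u^-1 * y)%g / Num.sqrt (W (u^-1 * y)%g)))).
    apply: ler_sum => u _; rewrite mulrCA divff ?mulr1//.
    by rewrite gt_eqF// sqrtr_gt0.
  apply: cauchy_schwarz; rewrite ?sqrtr_ge0 ?sqr_sqrtr//.
    by under eq_bigr do rewrite sqr_sqrtr ?(ltW (W0 _))//.
  by under eq_bigr do rewrite expr_div_n sqr_sqrtr ?(ltW (W0 _))//.
rewrite -mulr_sumr exchange_big /=.
apply: (@le_trans _ _ (c * \sum_(u <- U) \sum_(z <- Z) f u z)).
  rewrite ler_wpM2l// big_seq [leRHS]big_seq; apply: ler_sum => u uU.
  rewrite -(big_map (fun y => (u^-1 * y)%g) predT (f u)).
  apply: sum_le_subset => //; rewrite ?undup_uniq ?map_inj_uniq//.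
    exact: mulgI.
  move=> _ /mapP[y yY ->]; rewrite mem_undup; apply/allpairsP.
  by exists (u, y).
rewrite exchange_big /= exprMn expr2 -mulrA ler_wpM2l//.
apply: (@le_trans _ _ (\sum_(z <- Z) c * n z ^+ 2)).
  apply: ler_sum => z _; rewrite -mulr_suml mulrA ler_pdivrMr//.
  by rewrite mulrAC ler_wpM2r ?sqr_ge0.
by rewrite -mulr_sumr ler_wpM2l// l2_sum_le ?undup_uniq.
Qed.

End Schur.

Section Morphisms.
Variables (F G : groupType) (phi : F -> G).
Hypothesis phiM : forall s t, phi (s * t)%g = (phi s * phi t)%g.

Lemma morph1 : phi 1%g = 1%g.
Proof. by apply: (@mulgI _ (phi 1%g)); rewrite -phiM !mulg1. Qed.

Lemma morphV s : phi (s^-1)%g = ((phi s)^-1)%g.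
Proof. by apply/esym/mulg1_eq; rewrite -phiM mulgV morph1. Qed.

End Morphisms.

Section Coordinate.
Variables (F G : groupType) (phi psi : F -> G).
Hypothesis phiM : forall s t, phi (s * t)%g = (phi s * phi t)%g.
Hypothesis psiM : forall s t, psi (s * t)%g = (psi s * psi t)%g.

Hypothesis commute_psi : forall s t, commute (phi s) (psi t).
Hypothesis phi_psi : forall s t, phi s = psi t -> s = 1%g.

(** [F x F] acts freely on [G] on the left through [phi] and [psi]; a choice of
    orbit representatives gives an [F]-equivariant map from [G] to [F] that is
    constant along the second factor. *)
Lemma equivariant_coordinate : exists c : G -> F,
  forall s t x, c (phi s * psi t * x)%g = (s * c x)%g.
Proof.
pose orb x : set G := [set y | exists s t, x = (phi s * psi t * y)%g].
pose rep x := xget 1%g (orb x).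
have pp s t s' t' : (phi s * psi t * (phi s' * psi t') =
    phi (s * s') * psi (t * t'))%g.
  by rewrite phiM psiM !mulgA -(mulgA (phi s)) -commute_psi !mulgA.
have one : (phi 1 * psi 1 = 1)%g by rewrite (morph1 phiM) (morph1 psiM) mulg1.
have orbM s t x : orb (phi s * psi t * x)%g = orb x.
  apply/seteqP; split => y [s' [t' e]].
    exists (s^-1 * s')%g, (t^-1 * t')%g.
    by rewrite -pp -mulgA -e mulgA pp !mulVg one mul1g.
  by exists (s * s')%g, (t * t')%g; rewrite e mulgA pp.
have repP x : orb x (rep x).
  rewrite /rep; case: xgetP => [y -> //|/(_ x)]; case.
  by exists 1%g, 1%g; rewrite one mul1g.
have [c cP] := choice repP; exists c => s t x.
have [t1 e1] := cP x; have [t2] := cP (phi s * psi t * x)%g.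
have -> : rep (phi s * psi t * x)%g = rep x by rewrite /rep orbM.
rewrite {1}e1 mulgA pp => /mulIg e2.
have e3 : phi ((c (phi s * psi t * x))^-1 * (s * c x))%g =
          psi (t2 * (t * t1)^-1)%g.
  rewrite phiM psiM (morphV phiM).
  apply: (@mulgI _ (phi (c (phi s * psi t * x)%g))); rewrite mulVKg.
  apply: (@mulIg _ (psi (t * t1)%g)).
  rewrite e2 -!mulgA; congr (_ * _)%g; rewrite -psiM mulVg.
  by rewrite (morph1 psiM) mulg1.
by have /eqP := phi_psi e3; rewrite mulg_eq1 eqg_inv => /eqP.
Qed.

End Coordinate.

Section Contraction.
Variables (R : realType) (F G : groupType).

Lemma superharmonic_words (S : seq F) (w : F -> R) r n h :
  superharmonic (symmetrization S) w r ->
  \sum_(v <- words (symmetrization S) n) w (v * h)%g <= r ^+ n * w h /\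
  \sum_(v <- words (symmetrization S) n) w (v^-1 * h)%g <= r ^+ n * w h.
Proof.
move=> [w0 /andP[r0 _] wr]; elim: n h => [|n IH] h.
  by rewrite /= !big_seq1 invg1 !mul1g !mul1r.
split.
- rewrite big_words exchange_big exprS /= -mulrA.
  apply: (@le_trans _ _
      (r * \sum_(v <- words (symmetrization S) n) w (v * h)%g)).
    rewrite mulr_sumr; apply: ler_sum => v _.
    by under eq_bigr do rewrite -mulgA; exact: wr.
  by rewrite ler_wpM2l//; have [] := IH h.
- rewrite big_words exprSr -mulrA.
  apply: (@le_trans _ _
      (\sum_(s <- symmetrization S) r ^+ n * w (s^-1 * h)%g)).
    apply: ler_sum => s _; under eq_bigr do rewrite invgM -mulgA.
    by have [] := IH (s^-1 * h)%g.
  rewrite -mulr_sumr ler_wpM2l ?exprn_ge0//.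
  by rewrite (sum_symmetrization S (fun s => w (s * h)%g)).
Qed.

Variables (phi : F -> G) (g : G).
Hypothesis phiM : forall s t, phi (s * t)%g = (phi s * phi t)%g.

Definition conj_by t := (g * phi t * g^-1)%g.
Local Notation psi := conj_by.

Lemma conj_byM s t : psi (s * t)%g = (psi s * psi t)%g.
Proof. by rewrite /conj_by phiM !mulgA mulgVK. Qed.

Hypothesis commute_psi : forall s t, commute (phi s) (psi t).
Hypothesis phi_psi : forall s t, phi s = psi t -> s = 1%g.

(** [phi v g phi v^-1 = phi v psi v^-1 g], and the translations by the elements
    [phi v psi v^-1] are estimated with the weight pulled back along the
    coordinate. *)
Lemma conjugates_contract (S : seq F) (w : F -> R) r n (xi : l2 R G) :
  superharmonic (symmetrization S) w r ->
  l2norm (\sum_(v <- words (symmetrization S) n)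
            lreg (phi v * g * (phi v)^-1)%g xi) <= r ^+ n * l2norm xi.
Proof.
move=> wr; have [w0 /andP[r0 _] _] := wr.
have [c cE] := equivariant_coordinate phiM conj_byM commute_psi phi_psi.
pose U := [seq (phi v * psi (v^-1))%g | v <- words (symmetrization S) n].
have -> : \sum_(v <- words (symmetrization S) n)
    lreg (phi v * g * (phi v)^-1)%g xi = \sum_(u <- U) lreg u (lreg g xi).
  rewrite big_map; apply: eq_bigr => v _; rewrite -translationM; congr lreg.
  by rewrite /conj_by (@morphV _ _ phi phiM) !mulgA mulgVK.
rewrite -(l2norm_lreg g xi).
apply: (@schur_test _ _ U (w \o c)) => [x||x|x] /=.
- exact: w0.
- exact: exprn_ge0.
- rewrite big_map; have [_] := superharmonic_words n (c x) wr.
  apply: le_trans; apply: ler_sum => v _.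
  have -> : ((phi v * psi v^-1)^-1 * x = phi v^-1 * psi v * x)%g.
    rewrite invgM -(@morphV _ _ psi conj_byM) invgK -(@morphV _ _ phi phiM).
    by rewrite commute_psi.
  by rewrite cE.
- rewrite big_map; have [+ _] := superharmonic_words n (c x) wr.
  by apply: le_trans; apply: ler_sum => v _; rewrite cE.
Qed.

End Contraction.

(** * Powers averaging from rigid stabilizers *)

Section PowersAveraging.
Variables (R : realType) (F G : groupType) (X : Type).
Variable act : G -> X -> X.
Hypothesis act1 : forall x, act 1%g x = x.
Hypothesis actM : forall g h x, act (g * h)%g x = act g (act h x).
Hypothesis act_faithful : forall g h, (forall x, act g x = act h x) -> g = h.

Lemma actK g x : act (g^-1)%g (act g x) = x.
Proof. by rewrite -actM mulVg act1. Qed.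

Lemma actVK g x : act g (act (g^-1)%g x) = x.
Proof. by rewrite -actM mulgV act1. Qed.

Definition supported_on (g : G) (U : set X) := forall x, ~ U x -> act g x = x.

Definition displaces (g : G) (U : set X) := forall x, U x -> ~ U (act g x).

Lemma supported_preserves g U x : supported_on g U -> U x -> U (act g x).
Proof.
move=> gU Ux; apply: contrapT => nU; apply: (nU).
by have := gU _ nU; move=> /(congr1 (act (g^-1)%g)); rewrite !actK => ->.
Qed.

Lemma displacesV g U x : displaces g U -> U x -> ~ U (act (g^-1)%g x).
Proof. by move=> gU Ux /gU; rewrite actVK. Qed.

Section Displaced.
Variables (phi : F -> G) (g : G) (U : set X).
Hypothesis phiM : forall s t, phi (s * t)%g = (phi s * phi t)%g.
Hypothesis phi_inj : injective phi.
Hypothesis phiU : forall s, supported_on (phi s) U.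
Hypothesis gU : displaces g U.

Lemma conj_by_fixes t x : U x -> act (conj_by phi g t) x = x.
Proof.
move=> Ux; rewrite /conj_by !actM phiU ?actVK//; exact: displacesV.
Qed.

Lemma displaced_commute s t : commute (phi s) (conj_by phi g t).
Proof.
apply: act_faithful => x; rewrite (actM (phi s)) (actM (conj_by phi g t)).
have [Ux|nUx] := pselect (U x).
  by rewrite conj_by_fixes// conj_by_fixes//; exact: supported_preserves.
rewrite (phiU s nUx); apply: phiU.
rewrite /conj_by !actM; have [Uy|nUy] := pselect (U (act (g^-1)%g x)).
  by apply: gU; exact: supported_preserves.
by rewrite phiU// actVK.
Qed.

Lemma displaced_disjoint s t : phi s = conj_by phi g t -> s = 1%g.
Proof.
move=> e; apply: phi_inj; rewrite (morph1 phiM); apply: act_faithful => x.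
rewrite act1; have [Ux|nUx] := pselect (U x); last exact: phiU.
by rewrite e conj_by_fixes.
Qed.

End Displaced.

Variables (phi : G -> F -> G) (U : G -> set X).

(** The conjugators are products of elements supported on the sets [U g]. Since
    these sets are disjoint, conjugating [g] by elements supported on the other
    sets yields elements that still displace [U g]; the averaging over [U g]
    thus contracts all of them at the same rate. *)
Lemma powers_averaging (S : seq F) (w : F -> R) r (gs : seq G) (e : R) :
  superharmonic (symmetrization S) w r -> 0 < e -> uniq gs ->
  {in gs, forall g, (forall s t, phi g (s * t)%g = (phi g s * phi g t)%g) /\
    injective (phi g)} ->
  {in gs, forall g, (forall s, supported_on (phi g s) (U g)) /\
    displaces g (U g)} ->
  {in gs &, forall g h, g != h -> U g `&` U h = set0} ->
  exists Q : seq G, [/\ Q != [::],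
    {in Q, forall q x, (forall g, g \in gs -> ~ U g x) -> act q x = x} &
    {in gs, forall g (xi : l2 R G),
      l2norm (\sum_(q <- Q) lreg (q * g * q^-1)%g xi) <=
      e * (size Q)%:R * l2norm xi}].
Proof.
move=> wr e0; have [w0 /andP[r0 rS] _] := wr; set T := symmetrization S in wr rS.
have T0 : 0 < (size T)%:R :> R by exact: le_lt_trans r0 rS.
(* The length [n] of the words depends on [e] only, not on the elements to be
   averaged. *)
have [n rn] : exists n, r ^+ n <= e * (size T)%:R ^+ n.
  have : geometric 1 (r / (size T)%:R) @ \oo --> (0 : R).
    apply: cvg_geometric; rewrite ger0_norm ?divr_ge0// ltr_pdivrMr//.
    by rewrite mul1r.
  move=> /cvgr0Pnorm_le /(_ e e0) [n _ /(_ n (leqnn n))] /= H.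
  exists n; rewrite -ler_pdivrMr ?exprn_gt0// -expr_div_n.
  by apply: le_trans H; rewrite mul1r ler_norm.
elim: gs => [|g gs IH] ugs pgs Ugs dgs.
  by exists [:: 1%g]; split => // q; rewrite inE => /eqP -> x _; exact: act1.
move: ugs => /= /andP[ggs ugs].
have gin : g \in g :: gs by rewrite mem_head.
have gsin h : h \in gs -> h \in g :: gs by move=> hs; rewrite inE hs orbT.
have [||| Q' [Q'0 Q'fix Q'le]] := IH ugs.
- by move=> h /gsin; exact: pgs.
- by move=> h /gsin; exact: Ugs.
- by move=> h k /gsin hs /gsin ks; exact: dgs.
have [phiM phi_inj] := pgs g gin; have [phiU gU] := Ugs g gin.
pose Q1 := [seq phi g v | v <- words T n].
have sQ1 : (size Q1)%:R = (size T)%:R ^+ n :> R.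
  by rewrite size_map size_words natrX.
exists [seq (q * q')%g | q <- Q1, q' <- Q'].
have Q'U q x : q \in Q' -> U g x -> act q x = x.
  move=> qQ Ux; apply: Q'fix => // h hs Uh.
  have gh : g != h by apply: contraNneq ggs => ->.
  by have := dgs g h gin (gsin _ hs) gh; rewrite -subset0 => /(_ x); apply.
split.
- rewrite -size_eq0 size_allpairs muln_eq0 negb_or (size_eq0 Q') Q'0 andbT.
  by rewrite size_map size_words expn_eq0.
- move=> _ /allpairsP[[q q'] /= [/mapP[v _ ->] q'Q ->]] x nU.
  rewrite actM (Q'fix q')//; last by move=> h /gsin /nU.
  exact: (phiU _ _ (nU g gin)).
move=> h; rewrite inE => hgs xi; rewrite big_allpairs_dep size_allpairs natrM.
have [->|hg] := eqVneq h g.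
  rewrite exchange_big /=.
  apply: le_trans (l2norm_sum _ _) _.
  apply: (@le_trans _ _ (\sum_(q' <- Q') r ^+ n * l2norm xi)).
    rewrite big_seq [leRHS]big_seq; apply: ler_sum => q' q'Q.
    have gU' : displaces (q' * g * q'^-1)%g (U g).
      move=> x Ux; rewrite !actM.
      have -> : act (q'^-1)%g x = x.
        by rewrite -[in LHS](Q'U q' x)// actK.
      move=> Uy; have := gU x Ux; apply.
      by rewrite -(actK q' (act g x)) -[X in act _ X](Q'U q')// actK.
    rewrite big_map.
    under eq_bigr => v _.
      have -> : (phi g v * q' * g * (phi g v * q')^-1 =
          phi g v * (q' * g * q'^-1) * (phi g v)^-1)%g.
        by rewrite invgM !mulgA.
      over.
    exact: (conjugates_contract phiM (displaced_commute phiU gU')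
      (displaced_disjoint phiM phi_inj phiU gU') n xi wr).
  rewrite big_const_seq count_predT iter_addr_0 -(mulr_natl (_ * _)) sQ1 mulrA.
  by rewrite mulrA ler_wpM2r ?l2norm_ge0// [leRHS]mulrC ler_wpM2l.
have hs : h \in gs by move: hgs; rewrite (negPf hg).
apply: le_trans (l2norm_sum _ _) _.
apply: (@le_trans _ _ (\sum_(q <- Q1) e * (size Q')%:R * l2norm xi)).
  apply: ler_sum => q _; rewrite -(l2norm_lreg (q^-1)%g xi).
  apply: le_trans (Q'le h hs (lreg (q^-1)%g xi)).
  rewrite -[leRHS](l2norm_lreg q) le_eqVlt; apply/orP; left.
  apply/eqP; congr l2norm; apply/val_inj/funext => y.
  rewrite [RHS]translation_val !l2_val_sum; apply: eq_bigr => q' _.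
  by rewrite !translation_val !invgM !invgK !mulgA.
rewrite big_const_seq count_predT iter_addr_0 -(mulr_natl (_ * _)).
by rewrite le_eqVlt; apply/orP; left; apply/eqP; ring.
Qed.

End PowersAveraging.

(** * Ideals of the reduced C*-algebra *)

Section Operators.
Variables (R : realType) (G : groupType).
Local Notation C := R[i].
Local Notation normc := (@Normc.normc R).
Local Notation l2 := (l2 R G).
Implicit Types (a b : seq (C * G)) (A B : l2 -> l2) (xi : l2).

Definition group_op a : l2 -> l2 := \sum_(p <- a) p.1 *: lreg p.2.

Definition op_le A (M : R) := forall xi, l2norm (A xi) <= M * l2norm xi.

Lemma group_opE a xi : group_op a xi = \sum_(p <- a) p.1 *: lreg p.2 xi.
Proof. by rewrite /group_op fct_sumE. Qed.

Lemma group_op_val a xi y :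
  val (group_op a xi) y = \sum_(p <- a) p.1 * val xi (p.2^-1 * y)%g.
Proof. by rewrite group_opE l2_val_sum. Qed.

Lemma group_op_linear a : linear (group_op a).
Proof.
move=> c xi eta; rewrite !group_opE scaler_sumr -big_split; apply: eq_bigr => p _.
by rewrite translationZD scalerDr !scalerA mulrC.
Qed.

Lemma group_op_le a : op_le (group_op a) (\sum_(p <- a) normc p.1).
Proof.
move=> xi; rewrite group_opE mulr_suml; apply: le_trans (l2norm_sum _ _) _.
apply: ler_sum => p _; rewrite -(l2norm_lreg p.2 xi); exact: l2normZ_le.
Qed.

Lemma group_op_bounded a : bounded_operator (group_op a).
Proof.
split; first exact: group_op_linear.
by exists (\sum_(p <- a) normc p.1); exact: group_op_le.
Qed.

Lemma group_op_reduced a : reduced_cstar (group_op a).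
Proof.
split; first exact: group_op_bounded.
move=> e e0; exists (group_op a); first by exists a.
by move=> xi; rewrite subrr l2norm0 mulr_ge0 ?l2norm_ge0// ltW.
Qed.

Lemma reduced_approx A e : reduced_cstar A -> 0 < e ->
  exists a, op_le (A - group_op a) e.
Proof. by move=> [_ H] /H[_ [a ->] le]; exists a. Qed.

Lemma reduced_linear A : reduced_cstar A -> linear A.
Proof. by case=> -[]. Qed.

Lemma linear_opB A xi eta : linear A -> A (xi - eta) = A xi - A eta.
Proof.
move=> lA; have := lA (-1) eta xi.
by rewrite !scaleN1r [- eta + _]addrC [- A eta + _]addrC.
Qed.

Lemma lreg_reduced g : reduced_cstar (@lreg R G g).
Proof.
have -> : @lreg R G g = group_op [:: (1, g)].
  by apply/funext => xi; rewrite group_opE big_seq1 scale1r.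
exact: group_op_reduced.
Qed.

Lemma group_op_cat a b : group_op (a ++ b) = group_op a + group_op b.
Proof. by rewrite /group_op big_cat. Qed.

Lemma group_op_scale (c : C) a :
  group_op [seq (c * p.1, p.2) | p <- a] = c *: group_op a.
Proof.
rewrite /group_op big_map scaler_sumr; apply: eq_bigr => p _.
by rewrite scalerA.
Qed.

Lemma group_op_mul a b xi :
  group_op [seq (p.1 * q.1, (p.2 * q.2)%g) | p <- a, q <- b] xi =
  group_op a (group_op b xi).
Proof.
rewrite !group_opE big_allpairs_dep; apply: eq_bigr => p _ /=.
apply/val_inj/funext => y; rewrite l2_valZ translation_val !l2_val_sum mulr_sumr.
apply: eq_bigr => q _.
by rewrite !l2_valZ !translation_val invgM -mulgA mulrA.
Qed.

Lemma op_leD A B M N : op_le A M -> op_le B N -> op_le (A + B) (M + N).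
Proof.
move=> hA hB xi; rewrite mulrDl; apply: le_trans (l2norm_triangle _ _) _.
exact: lerD.
Qed.

Lemma op_leZ (c : C) A M : op_le A M -> op_le (c *: A) (normc c * M).
Proof.
move=> hA xi; apply: le_trans (l2normZ_le _ _) _.
by rewrite -mulrA ler_wpM2l ?normc_ge0.
Qed.

Lemma op_leN A M : op_le A M -> op_le (- A) M.
Proof. by move=> hA xi; rewrite /GRing.opp/= l2normN. Qed.

Lemma reduced_bound A : reduced_cstar A -> exists2 M, 0 <= M & op_le A M.
Proof.
move=> [[_ [M AM]] _]; exists (Num.max M 0); first by rewrite le_max lexx orbT.
move=> xi; apply: le_trans (AM xi) _.
by rewrite ler_wpM2r ?l2norm_ge0// le_max lexx.
Qed.

(** An operator that vanishes on the Dirac functions vanishes on the dense span of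
    these. *)
Lemma nonzero_coefficient A : reduced_cstar A -> A <> 0 ->
  exists x h, val (A (dirac R h)) x <> 0.
Proof.
move=> rA A0; apply: contrapT => H; apply: A0.
have lA := reduced_linear rA; have [N N0 AN] := reduced_bound rA.
have A0 : A 0 = 0.
  have := lA 1 0 0; rewrite scaler0 addr0 scale1r => /eqP.
  by rewrite -subr_eq subrr => /eqP.
have Ad h : A (dirac R h) = 0.
  apply/val_inj/funext => x; apply: contrapT => nz; apply: H.
  by exists x, h.
have As Y (f : G -> C) : A (\sum_(y <- Y) f y *: dirac R y) = 0.
  elim: Y => [|y Y IH]; first by rewrite big_nil.
  by rewrite big_cons lA IH Ad scaler0 addr0.
apply/funext => xi; apply: l2norm0_eq0.
apply/ler_addgt0Pr => e e0; rewrite add0r.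
have e'0 : 0 < e / (N + 1) by rewrite divr_gt0// ltr_wpDl.
have [Y le] := l2_truncation xi e'0.
have -> : A xi = A (xi - \sum_(y <- Y) val xi y *: dirac R y).
  have := lA 1 (xi - \sum_(y <- Y) val xi y *: dirac R y)
               (\sum_(y <- Y) val xi y *: dirac R y).
  by rewrite scale1r subrK As addr0 scale1r.
apply: le_trans (AN _) _; apply: le_trans (ler_wpM2l N0 le) _.
rewrite mulrCA ler_piMr ?(ltW e0)// ler_pdivrMr ?mul1r ?ltr_wpDl//.
by rewrite lerDl.
Qed.

Section IdealSum.
Variable J : set (l2 -> l2).
Hypothesis idJ : closed_ideal (@reduced_cstar R G) J.

Lemma idealZ (c : C) A : J A -> J (c *: A).
Proof.
case: idJ => _ [J0 JD] _ _ JA.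
by rewrite -[_ *: _]addr0; exact: JD.
Qed.

Lemma ideal_sum (I : Type) (s : seq I) (F : I -> l2 -> l2) :
  (forall i, J (F i)) -> J (\sum_(i <- s) F i).
Proof.
case: idJ => _ [J0 JD] _ _ JF; elim: s => [|i s IH]; rewrite ?big_nil// big_cons.
by rewrite -[F i]scale1r; exact: JD.
Qed.

Lemma ideal_conj g h A : J A -> J (lreg g \o (A \o lreg h)).
Proof.
case: idJ => _ _ JM _ JA; have [_ JAh] := JM (lreg h) A (lreg_reduced h) JA.
by have [] := JM (lreg g) _ (lreg_reduced g) JAh.
Qed.

(** A nonzero operator in the algebra has a nonzero coefficient; translating on
    both sides brings it to the diagonal. *)
Lemma ideal_normalized A : J A -> A <> 0 ->
  exists2 B, J B & val (B (dirac R 1%g)) 1%g = 1.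
Proof.
move=> JA A0; have Jr : J `<=` @reduced_cstar R G by case: idJ.
have [x [h nz]] := nonzero_coefficient (Jr _ JA) A0.
exists ((val (A (dirac R h)) x)^-1 *: (lreg (x^-1)%g \o (A \o lreg h))).
  by apply: idealZ; exact: ideal_conj.
transitivity ((val (A (dirac R h)) x)^-1 *
  val (lreg (x^-1)%g (A (lreg h (dirac R 1%g)))) 1%g); first by [].
rewrite translation_dirac translation_val !mulg1 invgK mulVf//.
exact/eqP.
Qed.

Lemma ideal_id : J id -> J = @reduced_cstar R G.
Proof.
case: idJ => Jr _ JM _ J1; apply/seteqP; split => // A rA.
by have [] := JM A id rA J1.
Qed.

End IdealSum.

Section Averaging.
Variables (Q : seq G) (k : C) (a : seq (C * G)).
Hypothesis kQ : k * \sum_(q <- Q) 1 = 1.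

Definition average B xi : l2 :=
  k *: \sum_(q <- Q) lreg q (B (lreg (q^-1)%g xi)).

Lemma average_group_op xi :
  average (group_op a) xi = (\sum_(p <- a | p.2 == 1%g) p.1) *: xi +
    \sum_(p <- a | p.2 != 1%g)
      (k * p.1) *: \sum_(q <- Q) lreg (q * p.2 * q^-1)%g xi.
Proof.
have conj q : lreg q (group_op a (lreg (q^-1)%g xi)) =
    \sum_(p <- a) p.1 *: lreg (q * p.2 * q^-1)%g xi.
  apply/val_inj/funext => y; rewrite translation_val group_op_val l2_val_sum.
  apply: eq_bigr => p _; rewrite l2_valZ !translation_val.
  by rewrite !invgM !invgK !mulgA.
have sumxi : \sum_(q <- Q) xi = (\sum_(q <- Q) 1 : C) *: xi.
  by rewrite scaler_suml; apply: eq_bigr => q _; rewrite scale1r.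
rewrite /average; under eq_bigr do rewrite conj.
rewrite exchange_big scaler_sumr /= (bigID (fun p : C * G => p.2 == 1%g)) /=.
congr (_ + _); last first.
  by apply: eq_bigr => p _; rewrite -scaler_sumr scalerA.
rewrite scaler_suml; apply: eq_bigr => p /eqP ->.
under eq_bigr do rewrite mulg1 mulgV translation1.
rewrite -[X in _ *: X]scaler_sumr sumxi scalerA mulrC -scalerA (scalerA k) kQ.
by rewrite scale1r.
Qed.

Lemma averageB A B xi : average (A - B) xi = average A xi - average B xi.
Proof.
rewrite /average -scalerBr -sumrB; congr (_ *: _); apply: eq_bigr => q _.
exact: val_inj.
Qed.

Lemma average_le B M : normc k = (size Q)%:R^-1 -> 0 < (size Q)%:R :> R ->
  op_le B M -> op_le (average B) M.
Proof.
move=> nk sQ0 BM xi.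
apply: le_trans (l2normZ_le _ _) _; rewrite nk ler_pdivrMl//.
apply: le_trans (l2norm_sum _ _) _.
apply: (@le_trans _ _ (\sum_(q <- Q) M * l2norm xi)).
  apply: ler_sum => q _; rewrite l2norm_lreg.
  by apply: le_trans (BM _) _; rewrite l2norm_lreg.
by rewrite big_const_seq count_predT iter_addr_0 -(mulr_natl (_ * _)).
Qed.

(** The part of an average of [B] off the diagonal is small when the averages of
    the translations by the support of an approximation of [B] are. *)
Lemma average_close B d : normc k = (size Q)%:R^-1 -> 0 < (size Q)%:R :> R ->
  0 < d -> op_le (B - group_op a) d -> val (B (dirac R 1%g)) 1%g = 1 ->
  (forall p xi, p \in a -> p.2 != 1%g ->
     l2norm (\sum_(q <- Q) lreg (q * p.2 * q^-1)%g xi) <=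
     d / (1 + \sum_(p <- a) normc p.1) * (size Q)%:R * l2norm xi) ->
  forall xi, l2norm (xi - average B xi) <= (d + (d + d)) * l2norm xi.
Proof.
move=> nk sQ0 d0 Ba B1 QP xi; rewrite l2norm_distC.
pose M := 1 + \sum_(p <- a) normc p.1.
have M1 : 0 < M.
  by rewrite ltr_wpDr// sumr_ge0// => p _; exact: normc_ge0.
pose alpha := \sum_(p <- a | p.2 == 1%g) p.1.
have alphaE : val (group_op a (dirac R 1%g)) 1%g = alpha.
  rewrite group_op_val /alpha [RHS]big_mkcond; apply: eq_bigr => p _.
  by rewrite dirac_val mulg1 invg_eq1; case: eqP; rewrite ?mulr1 ?mulr0.
have alpha1 : normc (alpha - 1) <= d.
  rewrite -opprB normc_opp -alphaE -{1}B1 -l2_valB.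
  apply: le_trans
    (l2_coef_le (B (dirac R 1%g) - group_op a (dirac R 1%g)) 1%g) _.
  by apply: le_trans (Ba _) _; rewrite ler_piMr ?l2norm_dirac// ltW.
(* Averaging fixes the diagonal part [alpha] of [group_op a]; each of the three
   terms contributes at most [d]. *)
have -> : average B xi - xi = average (B - group_op a) xi + ((alpha - 1) *: xi +
   \sum_(p <- a | p.2 != 1%g)
     (k * p.1) *: \sum_(q <- Q) lreg (q * p.2 * q^-1)%g xi).
  rewrite averageB average_group_op scalerBl scale1r -/alpha.
  set x1 := average B xi; set x2 := alpha *: xi; set x3 := \sum_(p <- a | _) _.
  rewrite [x2 + x3]addrC opprD !addrA.
  by rewrite -(addrA _ (- x2) x2) addNr addr0 addrAC subrK.
apply: le_trans (l2norm_triangle _ _) _; rewrite !mulrDl.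
apply: lerD; first exact: average_le.
apply: le_trans (l2norm_triangle _ _) _; apply: lerD.
  by apply: le_trans (l2normZ_le _ _) _; rewrite ler_wpM2r ?l2norm_ge0.
rewrite -big_filter; apply: le_trans (l2norm_sum _ _) _.
apply: (@le_trans _ _ (\sum_(p <- [seq p <- a | p.2 != 1%g])
    normc p.1 * (d / M * l2norm xi))).
  rewrite big_seq [leRHS]big_seq; apply: ler_sum => p pa.
  apply: le_trans (l2normZ_le _ _) _; rewrite Normc.normcM nk.
  rewrite -mulrA mulrCA ler_wpM2l ?normc_ge0// ler_pdivrMl//.
  rewrite mulrA [_%:R * _]mulrC; move: pa; rewrite mem_filter => /andP[? ?].
  exact: QP.
rewrite -mulr_suml; set sa := \sum_(p <- _) _.
have saM : sa <= M.
  rewrite /sa big_filter big_mkcond /M -[leLHS]add0r lerD//.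
  by apply: ler_sum => p _; case: ifP; rewrite ?normc_ge0.
have -> : sa * (d / M * l2norm xi) = (d * l2norm xi) * (sa / M) by ring.
have dx : 0 <= d * l2norm xi by rewrite mulr_ge0 ?l2norm_ge0 ?(ltW d0).
apply: ler_piMr => //.
by rewrite ler_pdivrMr// mul1r.
Qed.

End Averaging.

(** A nonzero ideal contains an operator with diagonal coefficient [1]; averaging
    its conjugates kills every other coefficient in norm, so the identity is in
    the closure of the ideal. *)
Lemma powers_simple :
  (forall (gs : seq G) (e : R), 0 < e -> {in gs, forall g, g != 1%g} ->
     exists2 Q : seq G, Q != [::] &
       {in gs, forall g xi, l2norm (\sum_(q <- Q) lreg (q * g * q^-1)%g xi) <=
                            e * (size Q)%:R * l2norm xi}) ->
  cstar_simple R G.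
Proof.
move=> PA J idJ; have [Jr [J0 JD] JM Jc] := idJ.
have [sJ|/existsNP[A /not_implyP[JA A0]]] := pselect (forall A, J A -> A = 0).
  by left; apply/seteqP; split => [A /sJ //|A ->].
right; apply: (ideal_id idJ).
have [B JB B1] := ideal_normalized idJ JA A0.
apply: Jc; split.
  by split=> //; exists 1 => xi; rewrite mul1r.
move=> e e0; pose d := e / 3; have d0 : 0 < d by rewrite divr_gt0.
have [a Ba] := reduced_approx (Jr _ JB) d0.
pose M := 1 + \sum_(p <- a) normc p.1.
have M1 : 0 < M.
  by rewrite ltr_wpDr// sumr_ge0// => p _; exact: normc_ge0.
have [|g|Q Q0 QP] := PA [seq p.2 | p <- a & p.2 != 1%g] (d / M).
- by rewrite divr_gt0.
- by move=> /mapP[p]; rewrite mem_filter => /andP[p1 _] ->.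
have sQ0 : 0 < (size Q)%:R :> R by rewrite ltr0n lt0n size_eq0.
pose k : C := ((size Q)%:R^-1 : R)%:C%C.
have nk : normc k = (size Q)%:R^-1.
  by rewrite normc_real ger0_norm// invr_ge0 ltW.
have kQ : k * \sum_(q <- Q) 1 = 1.
  rewrite big_const_seq count_predT iter_addr_0.
  rewrite /k -(rmorph_nat (@real_complex R)) -rmorphM mulVf ?rmorph1//.
  by rewrite gt_eqF.
exists (k *: \sum_(q <- Q) (lreg q \o (B \o lreg (q^-1)%g))).
  apply: (idealZ idJ); apply: (ideal_sum idJ) => q; exact: (ideal_conj idJ).
move=> xi.
have -> : (k *: \sum_(q <- Q) (lreg q \o (B \o lreg (q^-1)%g))) xi =
    average Q k B xi.
  by rewrite /average -[LHS]/(k *: _) fct_sumE.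
have -> : e = d + (d + d) by rewrite /d; field.
apply: (@average_close Q k a kQ) => // p eta pa p1; apply: QP.
by apply: map_f; rewrite mem_filter p1.
Qed.

End Operators.

(** * Amenable subgroups and the quasi-regular representation *)

Section DiracSums.
Variables (R : realType) (G : groupType).
Local Notation C := R[i].
Local Notation normc := (@Normc.normc R).
Implicit Types (L V W : seq G).

Lemma coincidences_sym V W : coincidences R V W = coincidences R W V.
Proof.
rewrite /coincidences exchange_big; apply: eq_bigr => w _; apply: eq_bigr => v _.
by rewrite eq_sym.
Qed.

Definition dirac_sum L : l2 R G := \sum_(w <- L) dirac R w.

Lemma dirac_sum_val L x : val (dirac_sum L) x = (mult R L x)%:C%C.
Proof.
rewrite l2_val_sum multE rmorph_sum; apply: eq_bigr => w _.
by rewrite dirac_val /= rmorph_nat.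
Qed.

Lemma coincidences_ge0 V W : 0 <= coincidences R V W.
Proof. by do 2!apply: sumr_ge0 => ? _; rewrite ler0n. Qed.

Lemma l2norm_dirac_sum L : l2norm (dirac_sum L) <= Num.sqrt (coincidences R L L).
Proof.
apply: l2norm_le => [|Y uY]; first exact: sqrtr_ge0.
rewrite sqr_sqrtr ?coincidences_ge0//.
have sY : {subset Y <= undup (Y ++ L)}.
  by move=> y yY; rewrite mem_undup mem_cat yY.
have sL : {subset L <= undup (Y ++ L)}.
  by move=> y yL; rewrite mem_undup mem_cat yL orbT.
rewrite (coincidencesE _ _ (undup_uniq (Y ++ L)) sL).
apply: le_trans (_ : \sum_(y <- Y) mult R L y * mult R L y <= _).
  apply: ler_sum => y _.
  by rewrite dirac_sum_val normc_real ger0_norm ?mult_ge0// expr2.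
apply: sum_le_subset => //; first exact: undup_uniq.
by move=> z; rewrite mulr_ge0 ?mult_ge0.
Qed.

Lemma pairing_dirac_sum L (xi : l2 R G) :
  normc (\sum_(w <- L) val xi w) <= l2norm xi * Num.sqrt (coincidences R L L).
Proof.
apply: le_trans (ler_normc_sum _ _) _.
have sL : {subset L <= undup L} by move=> y; rewrite mem_undup.
rewrite (sum_mult _ (undup_uniq L) sL) mulrC.
apply: cauchy_schwarz; rewrite ?sqrtr_ge0 ?l2norm_ge0 ?l2_sum_le ?undup_uniq//.
rewrite sqr_sqrtr ?coincidences_ge0// (coincidencesE _ _ (undup_uniq L) sL).
by under eq_bigr do rewrite expr2.
Qed.

Lemma pairing_group_op (b : seq (C * G)) L :
  \sum_(w <- L) val (group_op b (dirac_sum L)) w =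
  \sum_(p <- b) p.1 * (coincidences R (translate p.2 L) L)%:C%C.
Proof.
under eq_bigr do rewrite group_op_val.
rewrite exchange_big; apply: eq_bigr => p _ /=; rewrite -mulr_sumr; congr (_ * _).
rewrite coincidences_sym coincidences_sum_mult rmorph_sum.
apply: eq_bigr => w _ /=.
by rewrite dirac_sum_val mult_translate.
Qed.

End DiracSums.

Section AmenableSubgroup.
Variables (R : realType) (H G : groupType) (iota : H -> G).
Hypothesis iotaM : forall s t, iota (s * t)%g = (iota s * iota t)%g.
Hypothesis iota_inj : injective iota.
Hypothesis aH : amenable R H.
Local Notation C := R[i].
Local Notation normc := (@Normc.normc R).
Local Notation l2 := (l2 R G).

Implicit Types A B : l2 -> l2.

Definition in_image (g : G) : bool := `[< exists h, iota h = g >].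

Lemma coincidences_map (V W : seq H) :
  coincidences R (map iota V) (map iota W) = coincidences R V W.
Proof.
rewrite /coincidences big_map; apply: eq_bigr => v _; rewrite big_map.
by apply: eq_bigr => w _; rewrite (inj_eq iota_inj).
Qed.

(** Almost invariant vectors of [l^2(H)], seen in [l^2(G)], have matrix
    coefficients that tend to the indicator of the image of [H]: a translation
    by an element outside this image moves them to orthogonal vectors. *)
Lemma image_coefficient_le (b : seq (C * G)) e : 0 <= e ->
  op_le (group_op b) e ->
  normc (\sum_(p <- b) p.1 * (in_image p.2)%:R) <= e.
Proof.
move=> e0 be; apply/ler_addgt0Pr => d' d'0.
pose M := \sum_(p <- b) normc p.1.
have M0 : 0 <= M by apply: sumr_ge0 => p _; exact: normc_ge0.
have M1 : 0 < M + 1 by rewrite ltr_wpDl.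
pose d := d' / (M + 1); have d0 : 0 < d by rewrite divr_gt0.
(* Preimages of the elements [p.2] that have one; the others give [1]. *)
pose S := [seq xget 1%g [set h | iota h = p.2] | p <- b].
have [W W0 SW] := amenable_almost_invariant S aH d0.
pose L := [seq iota w | w <- W].
pose q := coincidences R L L.
have qE : q = coincidences R W W by rewrite /q coincidences_map.
have q0 : 0 < q by rewrite qE coincidences_gt0.
pose N (p : C * G) : R := coincidences R (translate p.2 L) L.
have NE p : p \in b -> `|N p - (in_image p.2)%:R * q| <= d * q.
  move=> pb; rewrite /in_image; case: asboolP => [ex|nex]; last first.
    have -> : N p = 0.
      rewrite /N /coincidences big_map big1_seq// => _ /mapP[w _ ->].
      rewrite big1_seq// => _ /mapP[w' _ ->]; case: eqP => // E; case: nex.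
      exists (w' * w^-1)%g; apply: (@mulIg _ (iota w)).
      by rewrite -iotaM mulgVK.
    by rewrite mul0r subr0 normr0 mulr_ge0// ltW.
  pose s := xget 1%g [set h | iota h = p.2].
  have sE : iota s = p.2 by exact: (xgetPex 1%g ex).
  have sS : s \in symmetrization S.
    rewrite inE mem_cat.
    by rewrite (map_f (fun p => xget 1%g [set h | iota h = p.2]) pb) orbT.
  have NsE : N p = coincidences R (translate s W) W.
    rewrite /N -coincidences_map; congr coincidences.
    by rewrite /translate /L -!map_comp; apply: eq_map => w /=; rewrite iotaM sE.
  have := SW s sS; have := coincidences_translate_le R s W.
  rewrite -NsE -qE mul1r => le1 le2; rewrite ler_norml.
  apply/andP; split; first by lra.
  by have := mulr_gt0 d0 q0; lra.
have E : q%:C%C * \sum_(p <- b) p.1 * (in_image p.2)%:R =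
    \sum_(w <- L) val (group_op b (dirac_sum R L)) w -
    \sum_(p <- b) p.1 * (N p - (in_image p.2)%:R * q)%:C%C.
  rewrite pairing_group_op -sumrB mulr_sumr; apply: eq_bigr => p _.
  rewrite -mulrBr -rmorphB /= subKr rmorphM rmorph_nat mulrCA; congr (_ * _).
  exact: mulrC.
rewrite -(ler_pM2l q0) -{1}(gtr0_norm q0) -normc_real -Normc.normcM E.
apply: le_trans (ler_normcD _ _) _; rewrite mulrDr normc_opp.
apply: lerD.
  apply: le_trans (pairing_dirac_sum _ _) _.
  have s0 : 0 <= Num.sqrt q by exact: sqrtr_ge0.
  apply: le_trans (ler_wpM2r s0 (be _)) _.
  rewrite -mulrA mulrC; apply: ler_wpM2r => //.
  rewrite -[leRHS](sqr_sqrtr (ltW q0)) expr2.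
  by apply: ler_wpM2r => //; exact: l2norm_dirac_sum.
apply: le_trans (ler_normc_sum _ _) _.
apply: (@le_trans _ _ (\sum_(p <- b) normc p.1 * (d * q))).
  rewrite big_seq [leRHS]big_seq; apply: ler_sum => p pb.
  by rewrite Normc.normcM normc_real ler_wpM2l ?normc_ge0// NE.
rewrite -mulr_suml -/M mulrCA mulrA mulrC ler_wpM2l ?(ltW q0)//.
by rewrite /d mulrAC ler_pdivrMr// ler_wpM2l ?(ltW d'0)// lerDl.
Qed.

(** The coefficient of [group_op b] in the quasi-regular representation on the
    left cosets of the image of [H], between the cosets of [t] and of
    [s^-1]. *)
Definition coset_coefficient (s t : G) (b : seq (C * G)) : C :=
  \sum_(p <- b) p.1 * (in_image (s * p.2 * t)%g)%:R.

Lemma coset_coefficient_le s t b e : 0 <= e -> op_le (group_op b) e ->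
  normc (coset_coefficient s t b) <= e.
Proof.
move=> e0 be; pose b' := [seq (p.1, (s * p.2 * t)%g) | p <- b].
have := @image_coefficient_le b' e e0; rewrite big_map; apply => xi.
have -> : group_op b' xi = lreg s (group_op b (lreg t xi)).
  apply/val_inj/funext => y; rewrite translation_val !group_op_val big_map.
  apply: eq_bigr => p _; rewrite translation_val /=; congr (_ * sval xi _).
  by rewrite !invgM !mulgA.
by rewrite l2norm_lreg -(l2norm_lreg t xi); exact: be.
Qed.

Lemma coset_coefficient_cat s t a b : coset_coefficient s t (a ++ b) =
  coset_coefficient s t a + coset_coefficient s t b.
Proof. exact: big_cat. Qed.

Lemma coset_coefficient_scale s t (c : C) b :
  coset_coefficient s t [seq (c * p.1, p.2) | p <- b] =
  c * coset_coefficient s t b.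
Proof.
rewrite /coset_coefficient big_map mulr_sumr; apply: eq_bigr => p _.
by rewrite mulrA.
Qed.

Lemma coset_coefficient_mulr s t a b :
  coset_coefficient s t [seq (p.1 * q.1, (p.2 * q.2)%g) | p <- a, q <- b] =
  \sum_(p <- a) p.1 * coset_coefficient (s * p.2)%g t b.
Proof.
rewrite /coset_coefficient big_allpairs_dep; apply: eq_bigr => p _.
by rewrite mulr_sumr; apply: eq_bigr => q _; rewrite -mulrA !mulgA.
Qed.

Lemma coset_coefficient_mull s t a b :
  coset_coefficient s t [seq (p.1 * q.1, (p.2 * q.2)%g) | p <- a, q <- b] =
  \sum_(q <- b) q.1 * coset_coefficient s (q.2 * t)%g a.
Proof.
rewrite /coset_coefficient big_allpairs_dep exchange_big; apply: eq_bigr => q _.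
rewrite mulr_sumr; apply: eq_bigr => p _ /=.
by rewrite mulrAC mulrC !mulgA mulrA.
Qed.

(** The operators of the reduced C*-algebra that act as [0] on the left cosets of
    the image of [H]. The quasi-regular representation is only defined on finite
    sums of translations; an operator [A] acts as [0] when the coefficients of
    all finite sums within [e] of [A] are at most [e]. *)
Definition coset_kernel : set (l2 -> l2) :=
  [set A | reduced_cstar A /\ forall s t b e, 0 <= e ->
     op_le (A - group_op b) e -> normc (coset_coefficient s t b) <= e].

(** One approximation is enough: two approximations of [A] differ by a small
    operator, whose coefficients are small by [coset_coefficient_le]. *)
Lemma coset_kernelP A : reduced_cstar A ->
  (forall s t e, 0 < e -> exists b,
     op_le (A - group_op b) e /\ normc (coset_coefficient s t b) <= e) ->
  coset_kernel A.
Proof.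
move=> rA hA; split => // s t b e e0 Ab; apply/ler_addgt0Pr => d d0.
have d2 : 0 < d / 2 by rewrite divr_gt0.
have [b' [Ab' b'd]] := hA s t _ d2.
pose b'' := b ++ [seq (-1 * p.1, p.2) | p <- b'].
have -> : coset_coefficient s t b = coset_coefficient s t b'' +
    coset_coefficient s t b'.
  by rewrite coset_coefficient_cat coset_coefficient_scale mulN1r subrK.
apply: le_trans (ler_normcD _ _) _.
have -> : e + d = (d / 2 + e) + d / 2 by lra.
apply: lerD => //; apply: coset_coefficient_le; first by rewrite addr_ge0// ltW.
rewrite group_op_cat group_op_scale scaleN1r.
have -> : group_op b - group_op b' = (A - group_op b') + - (A - group_op b).
  by rewrite opprB [RHS]addrC addrA subrK.
apply: op_leD => //; exact: op_leN.
Qed.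

Lemma coset_kernel_approx A e : coset_kernel A -> 0 < e ->
  exists b, op_le (A - group_op b) e /\
    forall s t, normc (coset_coefficient s t b) <= e.
Proof.
move=> [rA hA] e0; have [b Ab] := reduced_approx rA e0; exists b; split => // s t.
by apply: hA => //; exact: ltW.
Qed.

Lemma reducedP A : bounded_operator A ->
  (forall e, 0 < e -> exists b, op_le (A - group_op b) e) -> reduced_cstar A.
Proof.
move=> bA hA; split => // e /hA[b Ab]; exists (group_op b); first by exists b.
exact: Ab.
Qed.

Lemma coset_kernel_linear (c : C) A B :
  coset_kernel A -> coset_kernel B -> coset_kernel (c *: A + B).
Proof.
move=> kA kB; have [rA _] := kA; have [rB _] := kB.
have approx e : 0 < e -> exists b, op_le (c *: A + B - group_op b) e /\
    forall s t, normc (coset_coefficient s t b) <= e.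
  move=> e0; have e2 : 0 < e / 2 by rewrite divr_gt0.
  have c1 : 0 < normc c + 1 by rewrite ltr_wpDl ?normc_ge0.
  have e1 : 0 < e / 2 / (normc c + 1) by rewrite divr_gt0.
  have ce : normc c * (e / 2 / (normc c + 1)) <= e / 2.
    by rewrite mulrCA ler_piMr ?(ltW e2)// ler_pdivrMr// mul1r lerDl.
  have [a [Aa a0]] := coset_kernel_approx kA e1.
  have [b [Bb b0]] := coset_kernel_approx kB e2.
  exists ([seq (c * p.1, p.2) | p <- a] ++ b); split => [xi|s t].
    rewrite group_op_cat group_op_scale opprD addrACA -scalerBr.
    rewrite [e]splitr mulrDl; apply: le_trans (l2norm_triangle _ _) _.
    apply: lerD; last exact: Bb.
    apply: le_trans (op_leZ c Aa xi) _.
    by rewrite ler_wpM2r ?l2norm_ge0.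
  rewrite coset_coefficient_cat coset_coefficient_scale [e]splitr.
  apply: le_trans (ler_normcD _ _) _; apply: lerD => //.
  by rewrite Normc.normcM; apply: le_trans ce; rewrite ler_wpM2l ?normc_ge0.
apply: coset_kernelP => [|s t e /approx[b [cb b0]]]; last by exists b.
apply: reducedP => [|e /approx[b [cb _]]]; last by exists b.
split.
  move=> d xi eta; rewrite -[LHS]/(c *: A _ + B _).
  rewrite -[RHS]/(d *: (c *: A xi + B xi) + (c *: A eta + B eta)).
  rewrite (reduced_linear rA) (reduced_linear rB).
  by rewrite !scalerDr !scalerA mulrC addrACA.
have [M M0 AM] := reduced_bound rA; have [N N0 BN] := reduced_bound rB.
by exists (normc c * M + N); apply: op_leD => //; exact: op_leZ.
Qed.

Lemma bounded_comp A B : reduced_cstar A -> reduced_cstar B ->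
  bounded_operator (A \o B).
Proof.
move=> rA rB; split.
  by move=> d xi eta /=; rewrite (reduced_linear rB) (reduced_linear rA).
have [M M0 AM] := reduced_bound rA; have [N N0 BN] := reduced_bound rB.
exists (M * N) => xi /=; apply: le_trans (AM _) _.
by rewrite -mulrA ler_wpM2l.
Qed.

Let product (a b : seq (C * G)) : seq (C * G) :=
  [seq (p.1 * q.1, (p.2 * q.2)%g) | p <- a, q <- b].

Let weight (a : seq (C * G)) : R := \sum_(p <- a) normc p.1.

Let weight_ge0 a : 0 <= weight a.
Proof. by apply: sumr_ge0 => p _; exact: normc_ge0. Qed.

Lemma coset_kernel_mull A B :
  reduced_cstar A -> coset_kernel B -> coset_kernel (A \o B).
Proof.
move=> rA kB; have [rB _] := kB; have [N N0 BN] := reduced_bound rB.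
have approx e : 0 < e -> exists b, op_le (A \o B - group_op b) e /\
    forall s t, normc (coset_coefficient s t b) <= e.
  move=> e0; have e2 : 0 < e / 2 by rewrite divr_gt0.
  have N1 : 0 < N + 1 by rewrite ltr_wpDl.
  have e1 : 0 < e / 2 / (N + 1) by rewrite divr_gt0.
  have Ne : e / 2 / (N + 1) * N <= e / 2.
    by rewrite mulrC mulrCA ler_piMr ?(ltW e2)// ler_pdivrMr// mul1r lerDl.
  have [a Aa] := reduced_approx rA e1.
  have a1 : 0 < weight a + 1 by rewrite ltr_wpDl.
  have e3 : 0 < e / 2 / (weight a + 1) by rewrite divr_gt0.
  have [b [Bb b0]] := coset_kernel_approx kB e3.
  have ae : weight a * (e / 2 / (weight a + 1)) <= e / 2.
    by rewrite mulrCA ler_piMr ?(ltW e2)// ler_pdivrMr// mul1r lerDl.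
  exists (product a b); split => [xi|s t].
    have -> : (A \o B - group_op (product a b)) xi =
        (A - group_op a) (B xi) + group_op a ((B - group_op b) xi).
      rewrite [(B - _) xi](_ : _ = B xi - group_op b xi)//.
      rewrite linear_opB; last exact: group_op_linear.
      rewrite [(A - _) _](_ : _ = A (B xi) - group_op a (B xi))//.
      by rewrite addrA subrK -group_op_mul.
    rewrite [e]splitr mulrDl; apply: le_trans (l2norm_triangle _ _) _.
    apply: lerD.
      apply: le_trans (Aa _) _; apply: le_trans (ler_wpM2l (ltW e1) (BN xi)) _.
      by rewrite mulrA ler_wpM2r ?l2norm_ge0.
    apply: le_trans (group_op_le a _) _.
    apply: le_trans (ler_wpM2l (weight_ge0 a) (Bb xi)) _.
    by rewrite mulrA ler_wpM2r ?l2norm_ge0.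
  rewrite coset_coefficient_mulr; apply: le_trans (ler_normc_sum _ _) _.
  apply: (@le_trans _ _ (\sum_(p <- a) normc p.1 * (e / 2 / (weight a + 1)))).
    apply: ler_sum => p _.
    by rewrite Normc.normcM ler_wpM2l ?normc_ge0.
  by rewrite -mulr_suml; apply: le_trans ae _; lra.
apply: coset_kernelP => [|s t e /approx[b [cb b0]]]; last by exists b.
apply: reducedP => [|e /approx[b [cb _]]]; last by exists b.
exact: bounded_comp.
Qed.

Lemma coset_kernel_mulr A B :
  coset_kernel A -> reduced_cstar B -> coset_kernel (A \o B).
Proof.
move=> kA rB; have [rA _] := kA; have [M M0 AM] := reduced_bound rA.
have approx e : 0 < e -> exists b, op_le (A \o B - group_op b) e /\
    forall s t, normc (coset_coefficient s t b) <= e.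
  move=> e0; have e2 : 0 < e / 2 by rewrite divr_gt0.
  have M1 : 0 < M + 1 by rewrite ltr_wpDl.
  have e1 : 0 < e / 2 / (M + 1) by rewrite divr_gt0.
  have Me : M * (e / 2 / (M + 1)) <= e / 2.
    by rewrite mulrCA ler_piMr ?(ltW e2)// ler_pdivrMr// mul1r lerDl.
  have [b Bb] := reduced_approx rB e1.
  have b1 : 0 < weight b + 1 by rewrite ltr_wpDl.
  have e3 : 0 < e / 2 / (weight b + 1) by rewrite divr_gt0.
  have [a [Aa a0]] := coset_kernel_approx kA e3.
  have be : weight b * (e / 2 / (weight b + 1)) <= e / 2.
    by rewrite mulrCA ler_piMr ?(ltW e2)// ler_pdivrMr// mul1r lerDl.
  exists (product a b); split => [xi|s t].
    have -> : (A \o B - group_op (product a b)) xi =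
        A ((B - group_op b) xi) + (A - group_op a) (group_op b xi).
      rewrite [(B - _) xi](_ : _ = B xi - group_op b xi)//.
      rewrite linear_opB; last exact: reduced_linear.
      rewrite [(A - _) _](_ : _ =
        A (group_op b xi) - group_op a (group_op b xi))//.
      by rewrite addrA subrK -group_op_mul.
    rewrite [e]splitr mulrDl; apply: le_trans (l2norm_triangle _ _) _.
    apply: lerD.
      apply: le_trans (AM _) _; apply: le_trans (ler_wpM2l M0 (Bb xi)) _.
      by rewrite mulrA ler_wpM2r ?l2norm_ge0.
    apply: le_trans (Aa _) _.
    apply: le_trans (ler_wpM2l (ltW e3) (group_op_le b xi)) _.
    by rewrite mulrA ler_wpM2r ?l2norm_ge0// mulrC.
  rewrite coset_coefficient_mull; apply: le_trans (ler_normc_sum _ _) _.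
  apply: (@le_trans _ _ (\sum_(p <- b) normc p.1 * (e / 2 / (weight b + 1)))).
    apply: ler_sum => p _.
    by rewrite Normc.normcM ler_wpM2l ?normc_ge0.
  by rewrite -mulr_suml; apply: le_trans be _; lra.
apply: coset_kernelP => [|s t e /approx[b [cb b0]]]; last by exists b.
apply: reducedP => [|e /approx[b [cb _]]]; last by exists b.
exact: bounded_comp.
Qed.

Lemma coset_kernel_closed : norm_closure coset_kernel `<=` coset_kernel.
Proof.
move=> A [bA hA].
have approx e : 0 < e -> exists b, op_le (A - group_op b) e /\
    forall s t, normc (coset_coefficient s t b) <= e.
  move=> e0; have e2 : 0 < e / 2 by rewrite divr_gt0.
  have [B kB AB] := hA _ e2; have [b [Bb b0]] := coset_kernel_approx kB e2.
  exists b; split => [|s t]; last by apply: le_trans (b0 s t) _; lra.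
  rewrite [e]splitr -(subrK B A) -addrA; exact: op_leD.
apply: coset_kernelP => [|s t e /approx[b [cb b0]]]; last by exists b.
by apply: reducedP => // e /approx[b [cb _]]; exists b.
Qed.

Lemma group_op_in_coset_kernel a :
  (forall s t, coset_coefficient s t a = 0) -> coset_kernel (group_op a).
Proof.
move=> a0; apply: coset_kernelP; first exact: group_op_reduced.
move=> s t e e0; exists a; rewrite a0 Normc.normc0 (ltW e0); split => // xi.
by rewrite subrr l2norm0 mulr_ge0 ?l2norm_ge0 ?(ltW e0).
Qed.

Lemma coset_kernel_ideal : closed_ideal (@reduced_cstar R G) coset_kernel.
Proof.
split => [A []//||A B rA kB|]; last exact: coset_kernel_closed.
  split; last by move=> c A B; exact: coset_kernel_linear.
  have -> : 0 = group_op [::] :> (l2 -> l2) by rewrite /group_op big_nil.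
  by apply: group_op_in_coset_kernel => s t; rewrite /coset_coefficient big_nil.
by split; [exact: coset_kernel_mull|exact: coset_kernel_mulr].
Qed.

Lemma coset_kernel_not_id : ~ coset_kernel id.
Proof.
move=> [_ /(_ 1%g 1%g [:: (1, 1%g)] 0 (lexx _))].
rewrite /coset_coefficient big_seq1 /= !mulg1 mul1r.
have -> : in_image 1%g by apply/asboolP; exists 1%g; exact: morph1.
rewrite Normc.normc1 ler10 => le10; suff : false by [].
apply: le10 => xi; rewrite mul0r -[X in l2norm X]/(xi - _) group_opE big_seq1.
by rewrite scale1r translation1 subrr l2norm0.
Qed.

(** [group_op a] lies in the ideal [coset_kernel], and the identity does not. *)
Lemma amenable_subgroup_not_simple a : group_op a <> 0 ->
  (forall s t, coset_coefficient s t a = 0) -> ~ cstar_simple R G.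
Proof.
move=> a0 /group_op_in_coset_kernel ka /(_ _ coset_kernel_ideal)[E|E].
  by move: ka; rewrite E.
apply: coset_kernel_not_id; rewrite E.
have -> : id = @lreg R G 1%g by apply/funext => xi; rewrite translation1.
exact: lreg_reduced.
Qed.

End AmenableSubgroup.

(** * Thompson's group [F] as maps of the unit interval *)

Section IntervalMaps.
Variable R : realType.
Local Notation circle := (circle R).
Local Notation proj := (@circle_proj R).
Implicit Types (x y t u : R) (p : circle).

Definition frac x : R := x - (Num.floor x)%:~R.

Definition coord p : R := frac (repr p).

Lemma frac_itv x : 0 <= frac x < 1.
Proof.
by rewrite /frac subr_ge0 ltrBlDl; have := floor_itv x; rewrite intrD.
Qed.

Lemma frac_id t : 0 <= t < 1 -> frac t = t.
Proof.
move=> t01; rewrite /frac; have /eqP -> : Num.floor t == 0.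
  by rewrite floor_eq add0r.
by rewrite subr0.
Qed.

Lemma proj_frac x : proj (frac x) = proj x.
Proof.
by apply/circle_projP; rewrite /frac addrAC subrr add0r rpredN intr_int.
Qed.

Lemma coord_itv p : 0 <= coord p < 1.
Proof. exact: frac_itv. Qed.

Lemma coordK p : proj (coord p) = p.
Proof. by rewrite /coord proj_frac /circle_proj reprK. Qed.

Lemma proj_inj t u : 0 <= t < 1 -> 0 <= u < 1 -> proj t = proj u -> t = u.
Proof.
move=> /andP[t0 t1] /andP[u0 u1] /circle_projP/intrP[n tuE].
have n1 : n < 1 by rewrite -(ltr_int R) -tuE; lra.
have n2 : -1 < n by rewrite -(ltr_int R) -tuE intrN; lra.
have n0 : n = 0 by lia.
by apply/eqP; rewrite -subr_eq0 tuE n0.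
Qed.

Lemma coord_proj x : coord (proj x) = frac x.
Proof.
by apply: proj_inj; rewrite ?frac_itv ?coord_itv// coordK proj_frac.
Qed.

Lemma coord_id t : 0 <= t < 1 -> coord (proj t) = t.
Proof. by move=> t01; rewrite coord_proj frac_id. Qed.

Lemma dyadicD x y : dyadic R x -> dyadic R y -> dyadic R (x + y).
Proof.
move=> [m [n ->]] [m' [n' ->]]; exists (m * 2 ^+ n' + m' * 2 ^+ n), (n + n')%N.
have p0 k : (2 : R) ^+ k != 0 by rewrite expf_neq0// pnatr_eq0.
by rewrite exprD intrD !intrM !rmorphXn /=; field; rewrite !p0.
Qed.

Lemma dyadic_int (n : int) : dyadic R n%:~R.
Proof. by exists n, 0%N; rewrite expr0 divr1. Qed.

Lemma dyadicN x : dyadic R x -> dyadic R (- x).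
Proof. by move=> [m [n ->]]; exists (- m), n; rewrite intrN mulNr. Qed.

Lemma dyadicM2 k x : dyadic R x -> dyadic R (2 ^+ k * x).
Proof.
move=> [m [n ->]]; exists (2 ^+ k * m), n.
by rewrite intrM rmorphXn mulrA.
Qed.

Lemma dyadicV2 k x : dyadic R x -> dyadic R (x / 2 ^+ k).
Proof.
move=> [m [n ->]]; exists m, (n + k)%N.
by rewrite exprD invfM mulrA.
Qed.

Lemma dyadic_frac x : dyadic R x -> dyadic R (frac x).
Proof. by move=> dx; apply: dyadicD => //; apply/dyadicN/dyadic_int. Qed.

Lemma circle_dyadicP x : circle_dyadic R (proj x) <-> dyadic R x.
Proof.
split => [[y dy] /circle_projP/intrP[n yx]|dx]; last by exists x.
have -> : x = y + (- n)%:~R by rewrite intrN -yx opprB addrC subrK.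
by apply: dyadicD => //; exact: dyadic_int.
Qed.

Lemma increasing_bijective_continuous (h h' : R -> R) :
  {homo h : x y / x < y} -> cancel h h' -> cancel h' h -> continuous h.
Proof.
move=> ih hK h'K x; apply/cvgrPdist_lt => e e0.
have lt y z : h y < z -> y < h' z.
  move=> hyz; rewrite ltNge; apply/negP; rewrite le_eqVlt => /predU1P[E|/ih].
    by rewrite -E h'K ltxx in hyz.
  by rewrite h'K => /(lt_trans hyz); rewrite ltxx.
have gt y z : z < h y -> h' z < y.
  move=> hyz; rewrite ltNge; apply/negP; rewrite le_eqVlt => /predU1P[E|/ih].
    by rewrite E h'K ltxx in hyz.
  by rewrite h'K => /(lt_trans hyz); rewrite ltxx.
near=> y; rewrite ltr_distlC; apply/andP; split.
  rewrite -(h'K (h x - e)); apply: ih; near: y; apply: lt_nbhsr; apply: gt.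
  by rewrite ltrBlDr ltrDl.
rewrite -(h'K (h x + e)); apply: ih; near: y; apply: lt_nbhsl; apply: lt.
by rewrite ltrDl.
Unshelve. all: by end_near. Qed.

Definition dyadic_pl (c : R -> R) : Prop :=
  exists B : seq R, {in B, forall b, dyadic R b} /\
    forall t, 0 < t < 1 -> t \notin B ->
      exists k : int, \forall u \near t, c u = c t + 2 ^ k * (u - t).

(** The restrictions to [0, 1) of an increasing homeomorphism of the interval and
    of its inverse; their values outside [0, 1) are arbitrary. *)
Definition interval_iso (c c' : R -> R) : Prop :=
  [/\ forall t u, 0 <= t -> t < u -> u < 1 -> c t < c u,
      forall t, 0 <= t < 1 -> [/\ 0 <= c t < 1, 0 <= c' t < 1,
                                  c' (c t) = t & c (c' t) = t] &
      forall t, 0 <= t < 1 -> dyadic R t -> dyadic R (c t) /\ dyadic R (c' t)].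

Lemma interval_iso_sym c c' : interval_iso c c' -> interval_iso c' c.
Proof.
move=> [ic cK dc]; split => [t u t0 tu u1|t t01|t t01 dt].
- have t01 : 0 <= t < 1 by rewrite t0 (lt_trans tu).
  have u01 : 0 <= u < 1 by rewrite u1 (le_trans t0 (ltW tu)).
  have [_ /andP[c't0 c't1] _ cc't] := cK _ t01.
  have [_ /andP[c'u0 c'u1] _ cc'u] := cK _ u01.
  rewrite ltNge le_eqVlt; apply/negP => /predU1P[E|lt].
    by move: tu; rewrite -cc't -cc'u E ltxx.
  have := ic _ _ c'u0 lt c't1; rewrite cc't cc'u => /(lt_trans tu).
  by rewrite ltxx.
- by have [] := cK t t01.
- by have [] := dc t t01 dt.
Qed.

Lemma floor_frac x : (Num.floor x)%:~R + frac x = x.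
Proof. by rewrite /frac addrC subrK. Qed.

Section Lift.
Variables c c' : R -> R.
Hypothesis cc' : interval_iso c c'.

Definition periodic_lift (d : R -> R) x : R := (Num.floor x)%:~R + d (frac x).

Lemma floor_periodic_lift x : Num.floor (periodic_lift c x) = Num.floor x.
Proof.
have [_ cK _] := cc'; have [/andP[c0 c1] _ _ _] := cK _ (frac_itv x).
by apply: floor_def; rewrite /periodic_lift intrD lerDl c0 ltrD2l.
Qed.

Lemma frac_periodic_lift x : frac (periodic_lift c x) = c (frac x).
Proof. by rewrite {1}/frac floor_periodic_lift /periodic_lift addrC addKr. Qed.

Lemma periodic_liftK x : periodic_lift c' (periodic_lift c x) = x.
Proof.
have [_ cK _] := cc'; have [_ _ c'c _] := cK _ (frac_itv x).
rewrite {1}/periodic_lift floor_periodic_lift frac_periodic_lift c'c.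
exact: floor_frac.
Qed.

Lemma periodic_lift_homo : {homo periodic_lift c : x y / x < y}.
Proof.
move=> x y xy; have [ic cK _] := cc'.
have [fxy|fxy] := eqVneq (Num.floor x) (Num.floor y).
  have /andP[x0 _] := frac_itv x; have /andP[_ y1] := frac_itv y.
  rewrite /periodic_lift fxy ltrD2l; apply: ic => //.
  by rewrite /frac fxy ltrD2r.
have {}fxy : Num.floor x < Num.floor y by rewrite lt_neqAle fxy le_floor// ltW.
have [/andP[_ cx] _ _ _] := cK _ (frac_itv x).
have [/andP[cy _] _ _ _] := cK _ (frac_itv y).
apply: (@lt_le_trans _ _ (Num.floor y)%:~R); last by rewrite /periodic_lift lerDl.
apply: (@lt_le_trans _ _ ((Num.floor x)%:~R + 1)).
  by rewrite /periodic_lift ltrD2l.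
by rewrite -(intrD _ _ 1) ler_int; lia.
Qed.

Lemma periodic_liftD1 x : periodic_lift c (x + 1) = periodic_lift c x + 1.
Proof.
have f1 : Num.floor (x + 1) = Num.floor x + 1.
  by rewrite floorDrz ?floor1 ?rpred1.
by rewrite /periodic_lift /frac f1 intrD opprD addrACA subrr addr0 addrAC.
Qed.

Lemma periodic_lift_near x : 0 < frac x ->
  \forall y \near x, Num.floor y = Num.floor x.
Proof.
move=> x0; have /andP[_ x1] := frac_itv x.
near=> y; apply: floor_def; apply/andP; split.
  apply/ltW; near: y; by apply: lt_nbhsr; rewrite -subr_gt0.
by near: y; apply: lt_nbhsl; move: x1; rewrite intrD /frac ltrBlDl.
Unshelve. all: by end_near. Qed.

Definition circle_map (d : R -> R) p : circle := proj (d (coord p)).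

Lemma circle_mapE x : circle_map c (proj x) = proj (periodic_lift c x).
Proof.
rewrite /circle_map coord_proj -(proj_frac (periodic_lift c x)).
by rewrite frac_periodic_lift.
Qed.

Lemma circle_mapK p : circle_map c' (circle_map c p) = p.
Proof.
have [_ cK _] := cc'; have [c01 _ c'c _] := cK _ (coord_itv p).
by rewrite /circle_map coord_id// c'c coordK.
Qed.

End Lift.

Lemma periodic_lift_continuous c c' : interval_iso c c' ->
  continuous (periodic_lift c).
Proof.
move=> cc'; apply: (@increasing_bijective_continuous _ (periodic_lift c')).
- exact: (periodic_lift_homo cc').
- exact: (periodic_liftK cc').
- exact: (periodic_liftK (interval_iso_sym cc')).
Qed.

Lemma circle_map_continuous c c' : interval_iso c c' -> continuous (circle_map c).
Proof.
move=> cc'; apply/quotient_continuous => x.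
rewrite (_ : _ \o _ = proj \o periodic_lift c); last first.
  by apply/funext => y; exact: (circle_mapE cc').
apply: continuous_comp; first exact: (periodic_lift_continuous cc').
exact: pi_continuous.
Qed.

(** The breakpoints of the periodic lift are those of [c] and the integers. *)
Lemma interval_iso_thompsonF c c' : interval_iso c c' -> dyadic_pl c ->
  exists f : thompsonF R,
    forall p, (val (val f) : homeo circle) p = circle_map c p.
Proof.
move=> cc' [B [Bd Bpl]]; have c'c := interval_iso_sym cc'.
pose h : homeo circle := Homeo (circle_mapK cc') (circle_mapK c'c)
  (circle_map_continuous cc') (circle_map_continuous c'c).
have sub d d' : interval_iso d d' ->
    circle_map d @` circle_dyadic R `<=` circle_dyadic R.
  move=> [_ _ dd] _ [_ [x dx <-] <-].
  rewrite /circle_map coord_proj; exists (d (frac x)) => //.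
  by have [] := dd _ (frac_itv x) (dyadic_frac dx).
have hT : thompsonT_pred h.
  apply/asboolP; split; last first.
    apply/seteqP; split; first exact: sub cc'.
    move=> p dp; exists (circle_map c' p); last exact: (circle_mapK c'c).
    by apply: (sub _ _ c'c); exists p.
  exists (periodic_lift c); split.
    split.
    - exact: (periodic_lift_continuous cc').
    - exact: (periodic_lift_homo cc').
    - exact: periodic_liftD1.
    - exact: (circle_mapE cc').
  exists [set` map proj (0 :: B)]; split; first exact: finite_seq.
    move=> p /mapP[b]; rewrite inE => /predU1P[->|bB] ->.
      by apply/circle_dyadicP; have := dyadic_int 0.
    by apply/circle_dyadicP; exact: Bd.
  move=> x nB.
  have x0 : frac x != 0.
    apply/eqP => x0; apply: nB; apply/mapP; exists 0; rewrite ?inE ?eqxx//.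
    by rewrite -x0 proj_frac.
  have xB : frac x \notin B.
    apply/negP => xB; apply: nB; apply/mapP; exists (frac x).
      by rewrite inE xB orbT.
    by rewrite proj_frac.
  have x01 : 0 < frac x < 1.
    by have /andP[xa ->] := frac_itv x; rewrite andbT lt_def x0.
  have [k kc] := Bpl _ x01 xB; exists k.
  have fx : 0 < frac x by case/andP: x01.
  have cf : continuous_at x (fun y => y - (Num.floor x)%:~R).
    by apply: cvgB; [exact: cvg_id|exact: cvg_cst].
  near=> y.
  have fy : Num.floor y = Num.floor x by near: y; exact: periodic_lift_near.
  rewrite /periodic_lift {1}/frac fy.
  have -> : c (y - (Num.floor x)%:~R) =
      c (frac x) + 2 ^ k * (y - (Num.floor x)%:~R - frac x).
    by near: y; exact: (cf _ kc).
  by rewrite addrA; congr (_ + _ * _); rewrite -addrA -opprD floor_frac.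
have hF : thompsonF_pred (Sub h hT : thompsonT R).
  apply/eqP; rewrite SubK /= /circle_map; congr proj.
  have c0 : 0 <= (0 : R) < 1 by rewrite lexx ltr01.
  rewrite coord_id//; have [ic cK _] := cc'.
  have [/andP[+ _] c'0 c'c0 ccK] := cK 0 c0.
  rewrite le_eqVlt => /predU1P[//|c00].
  have /andP[c'00 c'01] := c'0.
  move: c'00; rewrite le_eqVlt => /predU1P[E|c'00]; first by rewrite E ccK.
  have := ic 0 _ (lexx _) c'00 c'01; rewrite ccK => /(lt_trans c00).
  by rewrite ltxx.
by exists (Sub (Sub h hT : thompsonT R) hF) => p; rewrite !SubK.
Unshelve. all: by end_near. Qed.

End IntervalMaps.

Section Actions.
Variable R : realType.
Local Notation circle := (circle R).
Local Notation proj := (@circle_proj R).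
Implicit Types (x y t u : R) (p : circle).

Definition actT (g : thompsonT R) p : circle := (val g : homeo circle) p.

Definition actF (f : thompsonF R) p : circle := actT (val f) p.

Lemma actT1 p : actT 1%g p = p. Proof. by rewrite /actT val1. Qed.

Lemma actTM g h p : actT (g * h)%g p = actT g (actT h p).
Proof. by rewrite /actT valM. Qed.

Lemma actT_faithful g h : (forall p, actT g p = actT h p) -> g = h.
Proof. by move=> gh; apply/val_inj/homeoP. Qed.

Lemma actF1 p : actF 1%g p = p. Proof. by rewrite /actF val1 actT1. Qed.

Lemma actFM f g p : actF (f * g)%g p = actF f (actF g p).
Proof. by rewrite /actF valM actTM. Qed.

Lemma actF_faithful f g : (forall p, actF f p = actF g p) -> f = g.
Proof. by move=> fg; apply/val_inj/actT_faithful. Qed.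

Lemma actF0 f : actF f (proj 0) = proj 0.
Proof. exact: (eqP (valP f)). Qed.

Lemma actT_lift g :
  exists h, increasing_lift (actT g) h /\ dyadic_piecewise_linear h.
Proof. by have /asboolP[] := valP g. Qed.

Lemma actT_dyadic g p : circle_dyadic R p -> circle_dyadic R (actT g p).
Proof.
by have /asboolP[_ gd] := valP g => dp; rewrite -gd; exists p.
Qed.

Definition interval_map f t : R := coord (actF f (proj t)).

Lemma proj_interval_map f t : proj (interval_map f t) = actF f (proj t).
Proof. exact: coordK. Qed.

Lemma interval_mapM f g t :
  interval_map (f * g)%g t = interval_map f (interval_map g t).
Proof. by rewrite /interval_map actFM coordK. Qed.

Lemma interval_map1 t : 0 <= t < 1 -> interval_map 1%g t = t.
Proof. by move=> t01; rewrite /interval_map actF1 coord_id. Qed.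

(** A lift maps [0] to an integer, since [f] fixes the base point. *)
Lemma interval_map_lift f : exists2 h,
  increasing_lift (actF f) h /\ dyadic_piecewise_linear h &
  forall t, 0 <= t < 1 -> interval_map f t = h t - h 0.
Proof.
have [h [hl hpl]] := actT_lift (val f); exists h => // t /andP[t0 t1].
have [_ ih h1 fh] := hl.
have /circle_projP/intrP[n] : proj (h 0) = proj 0 by rewrite -fh; exact: actF0.
rewrite subr0 => h0n.
have ht : 0 <= h t - h 0 < 1.
  apply/andP; split.
    rewrite subr_ge0; move: t0; rewrite le_eqVlt => /predU1P[<-//|/ih].
    exact: ltW.
  by have := ih _ _ t1; rewrite -{1}[1]add0r h1 ltrBlDl.
rewrite /interval_map [actF f _]fh; rewrite -[in RHS](coord_id ht).
by congr coord; apply/circle_projP; rewrite h0n opprB addrC subrK intr_int.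
Qed.

Lemma interval_map_iso f : interval_iso (interval_map f) (interval_map (f^-1)%g).
Proof.
have dy g t : 0 <= t < 1 -> dyadic R t -> dyadic R (interval_map g t).
  move=> t01 dt; apply/circle_dyadicP; rewrite proj_interval_map.
  by apply: actT_dyadic; apply/circle_dyadicP.
split => [t u t0 tu u1|t t01|t t01 dt]; last by split; exact: dy.
- have [h [[_ ih _ _] _] hE] := interval_map_lift f.
  rewrite !hE ?ltrD2r; first exact: ih.
  + by rewrite u1 (le_trans t0 (ltW tu)).
  + by rewrite t0 (lt_trans tu).
- by rewrite -!interval_mapM mulVg mulgV interval_map1// !coord_itv.
Qed.

Lemma interval_map_pl f : dyadic_pl (interval_map f).
Proof.
have [h [hl [B [/finite_seqP[s ->] Bd Bpl]]] hE] := interval_map_lift f.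
exists [seq coord p | p <- s]; split.
  move=> _ /mapP[p ps ->]; apply/circle_dyadicP; rewrite coordK.
  exact: Bd.
move=> t t01 tB; have [t0 t1] := andP t01.
have [|k kh] := Bpl t.
  move=> ps; move/negP: tB; apply; apply/mapP; exists (proj t) => //.
  by rewrite coord_id// t1 ltW.
exists k; near=> u.
have u01 : 0 <= u < 1.
  apply/andP; split.
    by apply/ltW; near: u; exact: lt_nbhsr.
  by near: u; exact: lt_nbhsl.
rewrite !hE// ?t1 ?ltW//.
by rewrite addrAC; congr (_ - _); near: u.
Unshelve. all: by end_near. Qed.

Definition in_cell (k j : nat) x : bool := j%:R <= 2 ^+ k * x < j.+1%:R.

(** The conjugate of [c] by the affine map from [0, 1) onto the [j]-th dyadic
    interval of length [2 ^- k], extended by the identity. *)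
Definition shrink (k j : nat) (c : R -> R) t : R :=
  if in_cell k j t then (j%:R + c (2 ^+ k * t - j%:R)) / 2 ^+ k else t.

Lemma pow2_gt0 k : 0 < 2 ^+ k :> R.
Proof. by rewrite exprn_gt0. Qed.

Lemma in_cell_itv k j t : in_cell k j t -> 0 <= 2 ^+ k * t - j%:R < 1.
Proof. by rewrite /in_cell subr_ge0 ltrBlDl natr1. Qed.

Lemma in_cell_rescale k j t : 0 <= t < 1 -> in_cell k j ((j%:R + t) / 2 ^+ k).
Proof.
by rewrite /in_cell mulrC divfK ?gt_eqF ?pow2_gt0// lerDl -natr1 ltrD2l.
Qed.

Lemma in_cell01 k j t : (j < 2 ^ k)%N -> in_cell k j t -> 0 <= t < 1.
Proof.
move=> jk /andP[a b]; rewrite -(pmulr_rge0 _ (pow2_gt0 k)) (le_trans _ a)//=.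
rewrite -(ltr_pM2l (pow2_gt0 k)) mulr1 (lt_le_trans b)//.
by rewrite -natrX ler_nat.
Qed.

Section Shrink.
Variables (k j : nat).
Hypothesis jk : (j < 2 ^ k)%N.

Lemma in_cell_shrink c c' t : interval_iso c c' ->
  in_cell k j (shrink k j c t) = in_cell k j t.
Proof.
move=> [_ cK _]; rewrite /shrink; case: ifPn => [tc|/negPf//].
apply: in_cell_rescale.
by have [] := cK _ (in_cell_itv tc).
Qed.

Lemma shrink_rescale c t : 0 <= t < 1 ->
  shrink k j c ((j%:R + t) / 2 ^+ k) = (j%:R + c t) / 2 ^+ k.
Proof.
move=> t01; rewrite /shrink in_cell_rescale// [2 ^+ k * _]mulrC.
rewrite divfK ?gt_eqF ?pow2_gt0//.
by rewrite [_ + t]addrC addrK.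
Qed.

Lemma in_cellE t : in_cell k j t ->
  exists2 s, 0 <= s < 1 & t = (j%:R + s) / 2 ^+ k.
Proof.
move=> tc; exists (2 ^+ k * t - j%:R); first exact: in_cell_itv.
by rewrite addrC subrK mulrC mulKf// gt_eqF// pow2_gt0.
Qed.

Lemma shrink_comp c d d' t : interval_iso d d' ->
  shrink k j c (shrink k j d t) = shrink k j (c \o d) t.
Proof.
move=> dd'; have [tc|/negPf tc] := boolP (in_cell k j t); last first.
  by rewrite /shrink !tc.
have [s s01 ->] := in_cellE tc; have [_ dK _] := dd'.
by rewrite !shrink_rescale//; have [] := dK s s01.
Qed.

Lemma shrink_iso c c' : interval_iso c c' ->
  interval_iso (shrink k j c) (shrink k j c').
Proof.
move=> cc'; have c'c := interval_iso_sym cc'; have [ic cK dc] := cc'.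
have s01 d d' t : interval_iso d d' -> 0 <= t < 1 -> 0 <= shrink k j d t < 1.
  move=> dd' t01; have [tc|/negPf tc] := boolP (in_cell k j t); last first.
    by rewrite /shrink tc.
  by apply: (in_cell01 jk); rewrite (in_cell_shrink _ dd').
have sK d d' t : interval_iso d d' -> 0 <= t < 1 ->
    shrink k j d' (shrink k j d t) = t.
  move=> dd' t01; rewrite (shrink_comp _ _ dd').
  rewrite /shrink; case: ifPn => // tc; have [_ dK _] := dd'.
  have [_ _ /= -> _] := dK _ (in_cell_itv tc).
  by rewrite addrC subrK mulrC mulKf// gt_eqF// pow2_gt0.
have sd d d' t : interval_iso d d' -> 0 <= t < 1 -> dyadic R t ->
    dyadic R (shrink k j d t).
  move=> [_ _ dd] t01 dt; rewrite /shrink; case: ifPn => // tc.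
  apply: dyadicV2; apply: dyadicD; first exact: (dyadic_int _ j).
  have [] // := dd _ (in_cell_itv tc); apply: dyadicD; first exact: dyadicM2.
  exact/dyadicN/(dyadic_int _ j).
split => [t u t0 tu u1|t t01|t t01 dt].
- rewrite -(ltr_pM2l (pow2_gt0 k)).
  have tu' : 2 ^+ k * t < 2 ^+ k * u by rewrite ltr_pM2l ?pow2_gt0.
  have vs x : in_cell k j x ->
      j%:R <= 2 ^+ k * shrink k j c x < j.+1%:R.
    by move=> xc; rewrite -[_ && _]/(in_cell _ _ _) (in_cell_shrink _ cc').
  have [tc|tc] := boolP (in_cell k j t); have [uc|uc] := boolP (in_cell k j u).
  + rewrite /shrink tc uc ltr_pM2l ?pow2_gt0// ltr_pM2r ?invr_gt0 ?pow2_gt0//.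
    rewrite ltrD2l; apply: ic; rewrite ?ltrD2r//.
      by have /andP[] := in_cell_itv tc.
    by have /andP[] := in_cell_itv uc.
  + have /andP[_ b] := vs _ tc; rewrite {2}/shrink (negPf uc).
    apply: (lt_le_trans b); rewrite leNgt; apply/negP => ub.
    move/negP: uc; apply.
    rewrite /in_cell ub andbT; have /andP[a _] := tc.
    exact: le_trans a (ltW tu').
  + have /andP[a _] := vs _ uc; rewrite {1}/shrink (negPf tc).
    apply: (lt_le_trans _ a); rewrite ltNge; apply/negP => tb.
    move/negP: tc; apply.
    rewrite /in_cell tb /=; have /andP[_ b] := uc.
    exact: lt_trans tu' b.
  + by rewrite /shrink (negPf tc) (negPf uc).
- by split; [exact: s01 cc' t01|exact: s01 c'c t01|
             exact: sK cc' t01|exact: sK c'c t01].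
- by split; [exact: sd cc' t01 dt|exact: sd c'c t01 dt].
Qed.

Lemma shrink_pl c : dyadic_pl c -> dyadic_pl (shrink k j c).
Proof.
move=> [B [Bd Bpl]].
exists [seq (j%:R + b) / 2 ^+ k | b <- [:: 0, 1 & B]]; split.
  move=> _ /mapP[b bB ->]; apply: dyadicV2; apply: dyadicD.
    exact: (dyadic_int _ j).
  move: bB; rewrite !inE => /or3P[/eqP->|/eqP->|/Bd//].
    exact: (dyadic_int _ 0).
  exact: (dyadic_int _ 1).
move=> t t01 tB.
have nB b : b \in [:: 0, 1 & B] -> 2 ^+ k * t - j%:R != b.
  move=> bB; apply/eqP => E; move/negP: tB; apply; apply/mapP; exists b => //.
  by rewrite -E addrC subrK mulrC mulKf// gt_eqF// pow2_gt0.
have cf : continuous_at t (fun u => 2 ^+ k * u - j%:R).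
  by apply: cvgB; [apply: cvgM; [exact: cvg_cst|exact: cvg_id]|exact: cvg_cst].
set s := 2 ^+ k * t - j%:R in nB.
have cellE u : in_cell k j u = (0 <= 2 ^+ k * u - j%:R < 1).
  by rewrite /in_cell subr_ge0 ltrBlDl natr1.
have [s0|s0|s0] := ltgtP s 0; last 1 first.
- by have := nB 0; rewrite inE eqxx s0 eqxx => /(_ isT).
- exists 0; near=> u.
  have us : 2 ^+ k * u - j%:R < 0 by near: u; exact: (cf _ (lt_nbhsl s0)).
  rewrite /shrink !cellE [0 <= s]leNgt s0 [0 <= _ * u - _]leNgt us /=.
  by rewrite expr0z mul1r addrC subrK.
have [s1|s1|s1] := ltgtP s 1; last 1 first.
- by have := nB 1; rewrite !inE eqxx orbT s1 eqxx => /(_ isT).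
- have [||l lc] := Bpl s; first by rewrite s0 s1.
    by apply/negP => sB; have := nB s; rewrite !inE sB !orbT eqxx => /(_ isT).
  exists l; near=> u.
  have us0 : 0 < 2 ^+ k * u - j%:R by near: u; exact: (cf _ (lt_nbhsr s0)).
  have us1 : 2 ^+ k * u - j%:R < 1 by near: u; exact: (cf _ (lt_nbhsl s1)).
  have cu : c (2 ^+ k * u - j%:R) = c s + 2 ^ l * (2 ^+ k * u - j%:R - s).
    by near: u; exact: (cf _ lc).
  rewrite /shrink !cellE us1 (ltW us0) -/s s1 (ltW s0) /= cu /s.
  by field; rewrite gt_eqF// pow2_gt0.
- exists 0; near=> u.
  have us : 1 < 2 ^+ k * u - j%:R by near: u; exact: (cf _ (lt_nbhsr s1)).
  rewrite /shrink !cellE -/s [s < 1]ltNge (ltW s1).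
  rewrite [_ * u - _ < _]ltNge (ltW us) /= !andbF.
  by rewrite expr0z mul1r addrC subrK.
Unshelve. all: by end_near. Qed.

End Shrink.
End Actions.

(** * Elements supported on small dyadic arcs *)

Section Cells.
Variable R : realType.
Local Notation circle := (circle R).
Local Notation proj := (@circle_proj R).
Implicit Types (x y t u : R) (p : circle).

(** The standard generator of [F] with slopes [1 / 2], [1] and [2]. *)
Definition generator0 t : R :=
  if t < 1 / 2 then t / 2 else if t < 3 / 4 then t - 1 / 4 else 2 * t - 1.

Definition generator0_inv t : R :=
  if t < 1 / 4 then 2 * t else if t < 1 / 2 then t + 1 / 4 else (t + 1) / 2.

Lemma generator0_iso : interval_iso generator0 generator0_inv.
Proof.
have d4 : dyadic R (1 / 4) by exists 1, 2%N; rewrite -natrX.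
have d1 : dyadic R 1 := dyadic_int R 1.
have dV2 t : dyadic R t -> dyadic R (t / 2) by exact: (dyadicV2 1).
have dM2 t : dyadic R t -> dyadic R (2 * t) by exact: (dyadicM2 1).
split => [t u t0 tu u1|t /andP[t0 t1]|t /andP[t0 t1] dt].
- rewrite /generator0; case: (ltP t); case: (ltP u) => ? ?;
    rewrite ?(ltP t) //; try case: (ltP t (3 / 4)) => ?;
    try case: (ltP u (3 / 4)) => ?; lra.
- rewrite /generator0 /generator0_inv; split.
  + by case: ltP => ?; [|case: ltP => ?]; apply/andP; split; lra.
  + by case: ltP => ?; [|case: ltP => ?]; apply/andP; split; lra.
  + case: (ltP t (1 / 2)) => ?; [|case: (ltP t (3 / 4)) => ?];
      (case: ltP => ?; [|case: ltP => ?]); lra.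
  + case: (ltP t (1 / 4)) => ?; [|case: (ltP t (1 / 2)) => ?];
      (case: ltP => ?; [|case: ltP => ?]); lra.
- rewrite /generator0 /generator0_inv; split.
  + case: ltP => _; first exact: dV2.
    case: ltP => _; apply: dyadicD => //; last exact: dyadicN.
      exact: dyadicN.
    exact: dM2.
  + case: ltP => _; first exact: dM2.
    by case: ltP => _; [apply: dyadicD|apply/dV2/dyadicD].
Qed.

Lemma generator0_pl : dyadic_pl generator0.
Proof.
have d2 : dyadic R (1 / 2) by exists 1, 1%N; rewrite expr1.
have d3 : dyadic R (3 / 4) by exists 3, 2%N; rewrite -natrX.
exists [:: 1 / 2; 3 / 4]; split.
  by move=> b; rewrite !inE => /orP[]/eqP ->.
move=> t _; rewrite !inE negb_or => /andP[n2 n3].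
have [t2|t2|t2] := ltgtP t (1 / 2); last by rewrite t2 eqxx in n2.
  exists (- 1); near=> u; have u2 : u < 1 / 2 by near: u; exact: lt_nbhsl.
  by rewrite /generator0 t2 u2 exprN1; lra.
have [t3|t3|t3] := ltgtP t (3 / 4); last by rewrite t3 eqxx in n3.
  exists 0; near=> u.
  have u2 : 1 / 2 < u by near: u; exact: lt_nbhsr.
  have u3 : u < 3 / 4 by near: u; exact: lt_nbhsl.
  by rewrite /generator0 t3 u3 !ltNge (ltW t2) (ltW u2) /= expr0z; lra.
exists 1; near=> u.
have u3 : 3 / 4 < u by near: u; exact: lt_nbhsr.
have u2 : 1 / 2 < u by lra.
rewrite /generator0 !ltNge (ltW t2) (ltW u2) (ltW t3) (ltW u3) /= expr1z; lra.
Unshelve. all: by end_near. Qed.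

Lemma thompsonF_nontrivial : exists f : thompsonF R, f != 1%g.
Proof.
have [f fE] := interval_iso_thompsonF generator0_iso generator0_pl.
exists f; apply/eqP => f1.
have h2 : 0 <= (1 / 2 : R) < 1 by apply/andP; split; lra.
have : generator0 (1 / 2) = 1 / 2.
  have [_ cK _] := generator0_iso; have [c01 _ _ _] := cK _ h2.
  apply: (@proj_inj R) => //.
  have : actF f (proj (1 / 2)) = _ := fE (proj (1 / 2)).
  by rewrite f1 actF1 /circle_map coord_id.
by rewrite /generator0 ltxx; case: ifP => _; lra.
Qed.

Definition cell (k j : nat) : set circle := [set p | in_cell k j (coord p)].

Lemma cell_disjoint k i j p : cell k i p -> cell k j p -> i = j.
Proof.
move=> /andP[i1 i2] /andP[j1 j2].
have : (i%:R : R) < j.+1%:R by exact: le_lt_trans i1 j2.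
have : (j%:R : R) < i.+1%:R by exact: le_lt_trans j1 i2.
by rewrite !ltr_nat; lia.
Qed.

(** [F] acts on every dyadic arc through the affine identification with the
    unit interval. *)
Lemma cell_embedding k j : (j < 2 ^ k)%N ->
  exists E : thompsonF R -> thompsonF R,
  [/\ forall f g, E (f * g)%g = (E f * E g)%g, injective E &
      forall f, supported_on (@actF R) (E f) (cell k j)].
Proof.
move=> jk.
have /choice[E EE] : forall f, exists f' : thompsonF R,
    forall p, actF f' p = circle_map (shrink k j (interval_map f)) p.
  move=> f; have ff := interval_map_iso f.
  have [f' f'E] := interval_iso_thompsonF (shrink_iso jk ff)
    (shrink_pl _ _ (interval_map_pl f)).
  by exists f'.
exists E; split.
- move=> f g; apply: actF_faithful => p; rewrite actFM !EE /circle_map.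
  have [_ gK _] := shrink_iso jk (interval_map_iso g).
  have [gp _ _ _] := gK _ (coord_itv p).
  rewrite coord_id// (shrink_comp _ _ _ _ (interval_map_iso g)); congr proj.
  by rewrite /shrink; case: ifP => // _; rewrite interval_mapM.
- move=> f g fg; apply: actF_faithful => p.
  rewrite -(coordK p) -!proj_interval_map; congr proj.
  have p01 := coord_itv p; set t := coord p in p01 *.
  have tc : in_cell k j ((j%:R + t) / 2 ^+ k) by exact: in_cell_rescale.
  have t01 := in_cell01 jk tc.
  have := congr1 (fun f => coord (actF f (proj ((j%:R + t) / 2 ^+ k)))) fg.
  rewrite !EE /circle_map !coord_id// !shrink_rescale//.
  + by move/(mulIf (invr_neq0 (lt0r_neq0 (pow2_gt0 _ k)))) => /addrI.
  + have [_ cK _] := shrink_iso jk (interval_map_iso g).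
    by rewrite -shrink_rescale//; have [] := cK _ t01.
  + have [_ cK _] := shrink_iso jk (interval_map_iso f).
    by rewrite -shrink_rescale//; have [] := cK _ t01.
- move=> f p /negP np; by rewrite EE /circle_map /shrink ifN ?coordK.
Qed.

(** If [h] lifts [g], then [h x - x] lies strictly between consecutive integers,
    and so does [h y - y'] for [y] and [y'] close to [x]. *)
Lemma displaced_near (g : thompsonT R) x : actT g (proj x) <> proj x ->
  exists2 d : R, 0 < d & forall y y', `|y - x| < d -> `|y' - x| < d ->
    actT g (proj y) <> proj y'.
Proof.
have [h [[ch _ _ gh] _]] := actT_lift g.
rewrite gh => /circle_projP nint; set v := h x - x in nint.
pose n := Num.floor v.
have /andP[nv vn] := floor_itv v; rewrite -/n intrD in nv vn.
have {}nv : n%:~R < v.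
  rewrite lt_neqAle nv andbT; apply/eqP => E; apply: nint.
  by rewrite -E intr_int.
pose e := Num.min (v - n%:~R) (n%:~R + 1 - v) / 2.
have e0 : 0 < e.
  rewrite divr_gt0// lt_min; apply/andP; split; first by rewrite subr_gt0.
  by rewrite subr_gt0.
have e1 : 2 * e <= v - n%:~R.
  by rewrite mulrC divfK ?pnatr_eq0// ge_min lexx.
have e2 : 2 * e <= n%:~R + 1 - v.
  by rewrite mulrC divfK ?pnatr_eq0// ge_min lexx orbT.
have /cvgrPdist_lt /(_ e e0) /nbhs_ballP[d /= d0 hd] := ch x.
exists (Num.min d e); first by rewrite lt_min d0.
move=> y y'; rewrite !lt_min => /andP[yd _] /andP[_ y'e].
have hy : `|h x - h y| < e by apply: hd; rewrite /ball/= distrC.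
rewrite gh => /circle_projP/intrP[m hm].
move: hy y'e; rewrite !ltr_distlC => /andP[a1 a2] /andP[b1 b2].
have m1 : n < m by rewrite -(ltr_int R) -hm; rewrite /v in e1; lra.
have m2 : m < n + 1 by rewrite -(ltr_int R) -hm intrD; rewrite /v in e2; lra.
by move: m2; rewrite ltzD1 leNgt m1.
Qed.

(** The moved points form a nonempty open set, which is infinite. *)
Lemma moved_point (g : thompsonT R) (Y : seq R) : g != 1%g ->
  exists x, [/\ 0 <= x < 1, x \notin Y & actT g (proj x) <> proj x].
Proof.
move=> g1.
have [p gp] : exists p, actT g p <> p.
  apply: contrapT => H; move/eqP: g1; apply; apply: actT_faithful => p.
  by rewrite actT1; apply: contrapT => np; apply: H; exists p.
rewrite -(coordK p) in gp; have [d d0 gd] := displaced_near gp.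
have /andP[x0 x1] := coord_itv p; set x := coord p in x0 x1 gp gd.
suff /filter_ex[y [[xy y1] [yx yY]]] : \forall y \near x^'+,
    (x < y /\ y < 1) /\ (y < x + d /\ y \notin Y).
  exists y; split => //; first by rewrite y1 (le_trans x0 (ltW xy)).
  by apply: gd; rewrite ger0_norm ?subr_ge0 ?(ltW xy)// ltrBlDl.
have nY : \forall y \near x^'+, y \notin Y.
  elim: (Y) => [|c Y' IH]; first by near=> y.
  have nc : \forall y \near x^'+, y != c.
    have [cx|xc] := leP c x.
      near=> y; rewrite gt_eqF//; apply: (le_lt_trans cx).
      by near: y; exact: nbhs_right_gt.
    by near=> y; rewrite lt_eqF//; near: y; exact: nbhs_right_lt.
  by near=> y; rewrite inE negb_or; apply/andP; split; near: y.
near=> y; split; split; near: y => //.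
- exact: nbhs_right_gt.
- exact: nbhs_right_lt.
- by apply: nbhs_right_lt; rewrite ltrDl.
Unshelve. all: by end_near. Qed.

End Cells.

(** * C*-simplicity of [F] and [T] *)

Section ThompsonAveraging.
Variable R : realType.
Local Notation circle := (circle R).
Local Notation proj := (@circle_proj R).
Implicit Types (x y t u : R) (p : circle).

Lemma moved_points (gs : seq (thompsonT R)) (Y : seq R) :
  uniq gs -> {in gs, forall g, g != 1%g} ->
  exists x : thompsonT R -> R,
    {in gs, forall g, [/\ 0 <= x g < 1, x g \notin Y &
                          actT g (proj (x g)) <> proj (x g)]} /\
    {in gs &, injective x}.
Proof.
elim: gs Y => [|g gs IH] Y /=; first by move=> _ _; exists (fun=> 0).
move=> /andP[ggs ugs] gs1.
have [x0 [x01 x0Y gx0]] := moved_point Y (gs1 g (mem_head _ _)).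
have [|x [xP x_inj]] := IH (x0 :: Y) ugs.
  by move=> h hs; apply: gs1; rewrite inE hs orbT.
exists (fun h => if h == g then x0 else x h); split=> [h|h h'].
  rewrite inE; case: eqP => [-> _//|_ /= hs].
  by have [? + ?] := xP h hs; rewrite inE negb_or => /andP[_].
rewrite !inE; have [->|_] := eqVneq h g; have [->|_] := eqVneq h' g => //=.
- move=> _ hs E; have [_ + _] := xP h' hs.
  by rewrite inE E eqxx.
- move=> hs _ E; have [_ + _] := xP h hs.
  by rewrite inE E eqxx.
- exact: x_inj.
Qed.

Lemma near_all (I : eqType) (s : seq I) (P : I -> nat -> Prop) :
  {in s, forall i, \forall k \near \oo, P i k} ->
  \forall k \near \oo, {in s, forall i, P i k}.
Proof.
elim: s => [|i s IH] sP; first by near=> k.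
have iP : \forall k \near \oo, P i k by apply: sP; rewrite mem_head.
have {}IH : \forall k \near \oo, {in s, forall i, P i k}.
  by apply: IH => j js; apply: sP; rewrite inE js orbT.
near=> k => j; rewrite inE => /predU1P[->|]; first by near: k.
by move: j; near: k.
Unshelve. all: by end_near. Qed.

Lemma near_pow2 (d : R) : 0 < d -> \forall k \near \oo, 1 < 2 ^+ k * d.
Proof.
move=> d0; have : geometric 1 (2^-1 : R) @ \oo --> (0 : R).
  by apply: cvg_geometric; rewrite ger0_norm ?invr_ge0//; lra.
move=> /cvgr0Pnorm_lt /(_ d d0); apply: filterS => k.
rewrite /geometric/= mul1r ger0_norm ?exprn_ge0 ?invr_ge0//.
by rewrite exprVn -[X in X < d]mulr1 ltr_pdivrMl// pow2_gt0.
Qed.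

Definition cell_index k x : nat := Num.truncn (2 ^+ k * x).

Lemma in_cell_index k x : 0 <= x -> in_cell k (cell_index k x) x.
Proof.
by move=> x0; apply: truncn_itv; rewrite mulr_ge0// ltW// pow2_gt0.
Qed.

Lemma in_cell_dist k j x y : in_cell k j x -> in_cell k j y ->
  2 ^+ k * `|x - y| < 1.
Proof.
move=> /andP[x1 x2] /andP[y1 y2].
rewrite -{1}(gtr0_norm (pow2_gt0 R k)) -normrM mulrBr.
by rewrite -natr1 in x2 y2; rewrite ltr_norml; apply/andP; split; lra.
Qed.

(** Arcs around distinct moved points are disjoint and displaced once they are
    shorter than the distances between the points and than the radii of
    [displaced_near]. *)
Lemma displaced_cells (gs : seq (thompsonT R)) :
  uniq gs -> {in gs, forall g, g != 1%g} ->
  exists k (j : thompsonT R -> nat),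
    [/\ {in gs, forall g, (j g < 2 ^ k)%N /\
                           displaces (@actT R) g (cell k (j g))} &
        {in gs &, injective j}].
Proof.
move=> ugs gs1; have [x [xP x_inj]] := moved_points [::] ugs gs1.
have dis : \forall k \near \oo, {in gs, forall g,
    displaces (@actT R) g (cell k (cell_index k (x g)))}.
  apply: near_all => g ggs; have [/andP[x0 _] _ gx] := xP g ggs.
  have [d d0 gd] := displaced_near gx.
  near=> k => p cp cgp.
  have kd : 1 < 2 ^+ k * d by near: k; exact: near_pow2.
  have close y : in_cell k (cell_index k (x g)) y -> `|y - x g| < d.
    move=> cy; have := in_cell_dist cy (in_cell_index k x0).
    by move=> /lt_trans /(_ kd); rewrite ltr_pM2l ?pow2_gt0.
  by have := gd _ _ (close _ cp) (close _ cgp); rewrite !coordK.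
have inj : \forall k \near \oo, {in gs, forall g, {in gs, forall h,
    cell_index k (x g) = cell_index k (x h) -> g = h}}.
  apply: near_all => g ggs; apply: near_all => h hgs.
  have [->|gh] := eqVneq g h; first by near=> k.
  have d0 : 0 < `|x g - x h|.
    rewrite normr_gt0 subr_eq0; apply: contra_neq gh; exact: x_inj.
  near=> k => E.
  have kd : 1 < 2 ^+ k * `|x g - x h| by near: k; exact: near_pow2.
  have [/andP[xg0 _] _ _] := xP g ggs; have [/andP[xh0 _] _ _] := xP h hgs.
  have cg := in_cell_index k xg0; rewrite E in cg.
  by have := lt_trans (in_cell_dist cg (in_cell_index k xh0)) kd; rewrite ltxx.
near \oo => k.
exists k, (fun g => cell_index k (x g)); split.
  move=> g ggs; split; last by move: g ggs; near: k.
  have [/andP[x0 x1] _ _] := xP g ggs.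
  have /andP[+ _] := in_cell_index k x0.
  rewrite -(ltr_nat R) natrX => /le_lt_trans; apply.
  by rewrite gtr_pMr// pow2_gt0.
by move=> g h ggs hgs; move: h hgs; move: g ggs; near: k.
Unshelve. all: by end_near. Qed.

Lemma nonamenable_superharmonic (G : groupType) : ~ amenable R G ->
  exists S (w : G -> R) r, superharmonic (symmetrization S) w r.
Proof.
move=> nG; apply: contrapT => H; apply: nG.
apply: almost_invariant_amenable => S e e0.
have [ai|[w [r wr]]] := dichotomy R S; first exact: ai.
by case: H; exists S, w, r.
Qed.

(** [G] stands for [F] or [T], so that [rho] and [eps] are the identity and the
    inclusion, in one order or the other. *)
Lemma nonamenable_simple (G : groupType)
    (rho : G -> thompsonT R) (eps : thompsonF R -> G) :
  (forall g h, rho (g * h)%g = (rho g * rho h)%g) -> injective rho ->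
  (forall f g, eps (f * g)%g = (eps f * eps g)%g) ->
  (forall f, rho (eps f) = val f) ->
  ~ amenable R (thompsonF R) -> cstar_simple R G.
Proof.
move=> rhoM rho_inj epsM rho_eps /nonamenable_superharmonic[S [w [r wr]]].
apply: powers_simple => gs e e0 gs1.
have rho1 := morph1 rhoM.
have [||k [j [jP j_inj]]] := @displaced_cells (undup (map rho gs)).
- exact: undup_uniq.
- move=> h; rewrite mem_undup => /mapP[g ggs ->].
  by rewrite -rho1 (inj_eq rho_inj) gs1.
pose act g p := actT (rho g) p.
have in_gs g : g \in undup gs -> rho g \in undup (map rho gs).
  by rewrite !mem_undup => ggs; exact: map_f.
have [E EP] : exists E : G -> thompsonF R -> thompsonF R,
    forall g, g \in undup gs ->
    [/\ forall f g', E g (f * g')%g = (E g f * E g g')%g, injective (E g) &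
        forall f, supported_on (@actF R) (E g f) (cell k (j (rho g)))].
  have /choice[E EP] : forall g, exists E : thompsonF R -> thompsonF R,
      g \in undup gs ->
      [/\ forall f g', E (f * g')%g = (E f * E g')%g, injective E &
          forall f, supported_on (@actF R) (E f) (cell k (j (rho g)))].
    move=> g; have [ggs|] := boolP (g \in undup gs); last by exists id.
    have [jk _] := jP _ (in_gs g ggs).
    by have [E EP] := cell_embedding R jk; exists E.
  by exists E.
have [|||||||Q [Q0 _ QP]] := @powers_averaging R (thompsonF R) G circle act _ _ _
  (fun g f => eps (E g f)) (fun g => cell k (j (rho g))) S w r (undup gs) e wr e0.
- by move=> x; rewrite /act rho1 actT1.
- by move=> g h x; rewrite /act rhoM actTM.
- by move=> g h gh; apply/rho_inj/actT_faithful.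
- exact: undup_uniq.
- move=> g ggs; have [EM E_inj _] := EP g ggs; split.
    by move=> s t; rewrite EM epsM.
  move=> s t /(congr1 rho); rewrite !rho_eps => /val_inj; exact: E_inj.
- move=> g ggs; have [_ _ Es] := EP g ggs; split.
    by move=> s p np; rewrite /act rho_eps; exact: Es np.
  by have [_] := jP _ (in_gs g ggs).
- move=> g h ggs hgs gh; rewrite -subset0 => p [cg ch].
  have /(j_inj _ _ (in_gs g ggs) (in_gs h hgs))/rho_inj E' := cell_disjoint cg ch.
  by rewrite E' eqxx in gh.
by exists Q => // g ggs; apply: QP; rewrite mem_undup.
Qed.

Lemma group_op_neq0 (G : groupType) (a : seq (R[i] * G)) :
  \sum_(p <- a | p.2 == 1%g) p.1 != 0 -> group_op a <> 0.
Proof.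
move=> a1 a0; have := group_op_val a (dirac R 1%g) 1%g.
rewrite a0 => /esym E; move/eqP: a1; apply; rewrite big_mkcond.
apply: etrans E; apply: eq_bigr => p _; rewrite dirac_val mulg1 invg_eq1.
by case: eqP; rewrite ?mulr1 ?mulr0.
Qed.

(** The coset space of [F] modulo itself is a point, on which [1 - f] acts as
    [0]. *)
Lemma simple_F_nonamenable :
  cstar_simple R (thompsonF R) -> ~ amenable R (thompsonF R).
Proof.
move=> sF aF; have [f f1] := thompsonF_nontrivial R.
apply: (@amenable_subgroup_not_simple R _ _ id _ _ aF
  [:: (1, 1%g); (-1, f)] _ _ sF) => //.
  apply: group_op_neq0; rewrite !big_cons big_nil /= eqxx (negPf f1) addr0.
  exact: oner_neq0.
move=> s t; rewrite /coset_coefficient !big_cons big_nil /=.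
have img g : in_image (@id (thompsonF R)) g by apply/asboolP; exists g.
by rewrite !img !mulr1 addr0 subrr.
Qed.

Lemma in_imageF (g : thompsonT R) :
  in_image (val : thompsonF R -> thompsonT R) g = (actT g (proj 0) == proj 0).
Proof.
apply/asboolP/idP => [[f <-]|g0]; first exact/eqP/actF0.
by exists (Sub g g0); rewrite SubK.
Qed.

(** For [g] and [h] in [F] supported on the two halves of the circle, every
    point is fixed by [g] or by [h], so [(1 - g) (1 - h)] acts as [0] on the
    orbit of the base point. *)
Lemma simple_T_nonamenable :
  cstar_simple R (thompsonT R) -> ~ amenable R (thompsonF R).
Proof.
move=> sT aF; have [f f1] := thompsonF_nontrivial R.
have [E0 [E0M E0_inj E0s]] := @cell_embedding R 1 0 isT.
have [E1 [E1M E1_inj E1s]] := @cell_embedding R 1 1 isT.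
pose g := val (E0 f); pose h := val (E1 f).
have g1 : g != 1%g.
  by rewrite -(val1 (thompsonF R)) (inj_eq val_inj) -(morph1 E0M) (inj_eq E0_inj).
have h1 : h != 1%g.
  by rewrite -(val1 (thompsonF R)) (inj_eq val_inj) -(morph1 E1M) (inj_eq E1_inj).
apply: (@amenable_subgroup_not_simple R _ _
  (val : thompsonF R -> thompsonT R) _ _ aF
  [:: (1, 1%g); (-1, g); (-1, h); (1, (g * h)%g)] _ _ sT).
- by move=> s t; rewrite valM.
- exact: val_inj.
- apply: group_op_neq0; rewrite !big_cons big_nil /= eqxx (negPf g1) (negPf h1).
  case: ifP => _; rewrite ?addr0 ?oner_neq0//.
move=> s t; rewrite /coset_coefficient !big_cons big_nil /=.
rewrite !in_imageF !actTM actT1.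
set x := actT t (proj 0).
have [x0|x0] := pselect (cell 1 0 x).
  have -> : actT h x = x.
    by apply: E1s => x1; have := cell_disjoint x0 x1.
  by rewrite addr0; ring.
have -> : actT g x = x by exact: E0s.
have -> : actT g (actT h x) = actT h x.
  apply: E0s => hx0; apply: x0.
  suff <- : actT h x = x by [].
  apply: (can_inj (actK (@actT1 R) (@actTM R) h)).
  by apply: E1s => hx1; have := cell_disjoint hx0 hx1.
by rewrite addr0; ring.
Qed.

End ThompsonAveraging.

Theorem theorem1p6 (R : realType) :
  [<-> ~ amenable R (thompsonF R);
       cstar_simple R (thompsonF R);
       cstar_simple R (thompsonT R)].
Proof.
tfae.
- exact: (@nonamenable_simple R _ val id).
- move=> /simple_F_nonamenable.
  exact: (@nonamenable_simple R _ id val).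
- exact: simple_T_nonamenable.
Qed.
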